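(* Let $(K,v)$ be a henselian valued field of arbitrary rank, let $w$ be an extension of $v$ to $K(X)$, and let $Q$ be an abstract key polynomial (ABKP) for $w$. Then $Q$ has a saturated distinguished chain of ABKPs for $w$ if and only if there exist ABKPs $Q_0,Q_1,\dots,Q_r=Q$ for $w$ such that $\deg Q_0=1$, and $\deg Q_{i-1}<\deg Q_i$ and $Q_i\in\psi(Q_{i-1})$ for each $i$, $1\le i\le r$.
   Context: Let $\bar v$ be the extension of $v$ to a fixed algebraic closure $\overline K$ of $K$. For $\theta\in\overline K$, $\deg\theta=[K(\theta):K]$. For $f\in K[X]$ and a positive integer $b$, $\partial_b f=\frac{1}{b!}\frac{\partial^b f}{\partial X^b}$ is the $b$-th formal (Hasse) derivative, and $\epsilon(f)=\max_{b\in\mathbb N}\frac{w(f)-w(\partial_b f)}{b}$, where $\mathbb N$ is the set of positive integers (an element of the divisible hull of the value group $\Gamma_w$; terms with $\partial_b f=0$ count as $-\infty$). A monic nonconstant polynomial $Q\in K[X]$ is an abstract key polynomial (ABKP) for $w$ if every $f\in K[X]$ with $\epsilon(f)\ge\epsilon(Q)$ satisfies $\deg f\ge\deg Q$. ABKPs are irreducible over $K$. The $Q$-truncation of $w$ is $w_Q(f)=\min_i\{w(f_iQ^i)\}$, where $f=\sum_i f_iQ^i$, $\deg f_i<\deg Q$, is the $Q$-expansion of $f$; for an ABKP $Q$ it is a valuation on $K(X)$. Put $\alpha(Q)=\min\{\deg f\mid w_Q(f)<w(f)\}$ ($=\infty$ if $w_Q=w$) and $\psi(Q)=\{f\in K[X]\mid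 f\text{ monic},\ w_Q(f)<w(f),\ \deg f=\alpha(Q)\}$. A pair $(\theta,\alpha)$ of elements of $\overline K$ is a $(K,v)$-distinguished pair if: $\deg\theta>\deg\alpha$; $\bar v(\theta-\alpha)=\max\{\bar v(\theta-\beta)\mid\beta\in\overline K,\ \deg\beta<\deg\theta\}$; and $\bar v(\theta-\eta)<\bar v(\theta-\alpha)$ for every $\eta\in\overline K$ with $\deg\eta<\deg\alpha$. For irreducible polynomials $g,f$ over $K$, $(g,f)$ is a distinguished pair if there are a root $\theta$ of $g$ and a root $\alpha$ of $f$ such that $(\theta,\alpha)$ is a $(K,v)$-distinguished pair. A saturated distinguished chain for an element $\theta\in\overline K$ is a chain $\theta=\theta_r,\dots,\theta_0$ of elements of $\overline K$ with $(\theta_{i+1},\theta_i)$ a $(K,v)$-distinguished pair for $0\le i\le r-1$ and $\theta_0\in K$. Correspondingly, a saturated distinguished chain of ABKPs for $Q$ is a chain $(Q=Q_r,Q_{r-1},\dots,Q_0)$ of ABKPs for $w$ such that $(Q_i,Q_{i-1})$ is a distinguished pair for each $1\le i\le r$ and $\deg Q_0=1$. *)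

(* Defs.v *)
From HB Require Import structures.
From mathcomp Require Import all_boot all_order all_algebra.
From mathcomp Require Import generic_quotient classical_sets.

Set Implicit Arguments.
Unset Strict Implicit.
Unset Printing Implicit Defensive.

Import Order.TTheory GRing.Theory.
Local Open Scope classical_set_scope.
Local Open Scope quotient_scope.
Local Open Scope ring_scope.

Notation "x %:F" := (FracField.tofrac x) : ring_scope.

(* Totally ordered abelian groups, of arbitrary rank.  They are not declared  *)
(* with HB.structure because the join of Order.Total and GRing.Zmodule cannot *)
(* be inserted below the existing Num.RealDomain; instead, the carrier        *)
(* oag_sort G receives both structures.                                       *)

Record oagType := OagType {
  oag_zmod : zmodType;
  oag_le : rel oag_zmod;
  oag_le_refl : reflexive oag_le;
  oag_le_anti : antisymmetric oag_le;
  oag_le_trans : transitive oag_le;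
  oag_le_total : total oag_le;
  oag_leD : forall z x y : oag_zmod, oag_le x y -> oag_le (z + x) (z + y)
}.

Definition oag_sort (G : oagType) : Type := oag_zmod G.
Coercion oag_sort : oagType >-> Sortclass.

HB.instance Definition _ (G : oagType) := GRing.Zmodule.on (oag_sort G).
HB.instance Definition _ (G : oagType) :=
  Order.Le_isPOrder.Build ring_display (oag_sort G)
    (@oag_le_refl G) (@oag_le_anti G) (@oag_le_trans G).
HB.instance Definition _ (G : oagType) :=
  Order.POrder_isTotal.Build ring_display (oag_sort G) (@oag_le_total G).

Section OagTheory.
Variable G : oagType.
Implicit Types x y z : G.

Lemma oag_leDl z x y : x <= y -> z + x <= z + y.
Proof. exact: (@oag_leD G). Qed.

Lemma oag_ltD z x y : x < y -> z + x < z + y.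
Proof.
rewrite !lt_neqAle => /andP[neq le_xy].
by rewrite oag_leDl // andbT (inj_eq (addrI z)).
Qed.

Lemma oag_ltMn x y n : x < y -> x *+ n.+1 < y *+ n.+1.
Proof.
move=> lt_xy; elim: n => [|n IHn]; first by rewrite !mulr1n.
rewrite !(mulrS _ n.+1); apply: lt_trans (oag_ltD x IHn) _.
by rewrite ![_ + y *+ _]addrC; apply: oag_ltD.
Qed.

Lemma oag_leMn n : {mono (fun x => x *+ n.+1) : x y / x <= y}.
Proof. by apply: le_mono => x y; apply: oag_ltMn. Qed.

End OagTheory.

(* withtop T is T with an element +oo added on top, withbot T is T with an    *)
(* element -oo added at the bottom.                                           *)

Variant withtop (T : Type) := Fin of T | PInf.
Arguments PInf {T}.

Variant withbot (T : Type) := FinB of T | NInf.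
Arguments NInf {T}.

Definition option_of_withtop T (x : withtop T) :=
  if x is Fin a then Some a else None.
Definition withtop_of_option T (x : option T) :=
  if x is Some a then Fin a else PInf.
Lemma option_of_withtopK T :
  cancel (@option_of_withtop T) (@withtop_of_option T).
Proof. by case. Qed.

Definition option_of_withbot T (x : withbot T) :=
  if x is FinB a then Some a else None.
Definition withbot_of_option T (x : option T) :=
  if x is Some a then FinB a else NInf.
Lemma option_of_withbotK T :
  cancel (@option_of_withbot T) (@withbot_of_option T).
Proof. by case. Qed.

HB.instance Definition _ (T : choiceType) :=
  Choice.copy (withtop T) (can_type (@option_of_withtopK T)).
HB.instance Definition _ (T : choiceType) :=
  Choice.copy (withbot T) (can_type (@option_of_withbotK T)).

Section WithtopOrder.
Variables (d : Order.disp_t) (T : orderType d).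

Definition withtop_le (x y : withtop T) : bool :=
  match x, y with
  | _, PInf => true
  | PInf, Fin _ => false
  | Fin a, Fin b => (a <= b)%O
  end.

Fact withtop_le_refl : reflexive withtop_le.
Proof. by case=> //= a. Qed.

Fact withtop_le_anti : antisymmetric withtop_le.
Proof. by move=> [a|] [b|] //= /le_anti ->. Qed.

Fact withtop_le_trans : transitive withtop_le.
Proof. by move=> [a|] [b|] [c|] //=; apply: le_trans. Qed.

Fact withtop_le_total : total withtop_le.
Proof. by move=> [a|] [b|] //=; apply: le_total. Qed.

HB.instance Definition _ := Order.Le_isPOrder.Build d (withtop T)
  withtop_le_refl withtop_le_anti withtop_le_trans.
HB.instance Definition _ :=
  Order.POrder_isTotal.Build d (withtop T) withtop_le_total.

Definition withbot_le (x y : withbot T) : bool :=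
  match x, y with
  | NInf, _ => true
  | FinB _, NInf => false
  | FinB a, FinB b => (a <= b)%O
  end.

Fact withbot_le_refl : reflexive withbot_le.
Proof. by case=> //= a. Qed.

Fact withbot_le_anti : antisymmetric withbot_le.
Proof. by move=> [a|] [b|] //= /le_anti ->. Qed.

Fact withbot_le_trans : transitive withbot_le.
Proof. by move=> [a|] [b|] [c|] //=; apply: le_trans. Qed.

Fact withbot_le_total : total withbot_le.
Proof. by move=> [a|] [b|] //=; apply: le_total. Qed.

HB.instance Definition _ := Order.Le_isPOrder.Build d (withbot T)
  withbot_le_refl withbot_le_anti withbot_le_trans.
HB.instance Definition _ :=
  Order.POrder_isTotal.Build d (withbot T) withbot_le_total.

End WithtopOrder.

Definition withtop_map S T (j : S -> T) (x : withtop S) : withtop T :=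
  if x is Fin a then Fin (j a) else PInf.

Definition withtop_add (G : zmodType) (x y : withtop G) : withtop G :=
  if x is Fin a then (if y is Fin b then Fin (a + b) else PInf) else PInf.

(* The ordered set underlying the divisible hull of G: the quotient of the    *)
(* formal fractions (x, n), standing for x / (n + 1), by equality of          *)
(* fractions.  Since G is torsion free, x / m <= y / n iff n x <= m y.        *)

Section DivisibleHull.
Variable G : oagType.

Definition dfrac := (G * nat)%type.
HB.instance Definition _ := Choice.on dfrac.
Implicit Types a b c : dfrac.

Definition dfrac_le a b : bool := a.1 *+ b.2.+1 <= b.1 *+ a.2.+1.
Definition dfrac_eq a b : bool := a.1 *+ b.2.+1 == b.1 *+ a.2.+1.

Lemma dfrac_eq_le a b : dfrac_eq a b = dfrac_le a b && dfrac_le b a.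
Proof. by rewrite /dfrac_eq eq_le. Qed.

Lemma dfrac_le_refl : reflexive dfrac_le.
Proof. by move=> a; apply: lexx. Qed.

Lemma dfrac_le_trans : transitive dfrac_le.
Proof.
move=> [y n] [x m] [z p]; rewrite /dfrac_le /= => le_xy le_yz.
rewrite -(oag_leMn n) -!mulrnA (mulnC p.+1) (mulnC m.+1) !mulrnA.
have := le_xy; rewrite -(oag_leMn p) => /le_trans; apply.
by rewrite -!mulrnA mulnC !mulrnA oag_leMn.
Qed.

Lemma dfrac_eq_refl : reflexive dfrac_eq.
Proof. by move=> a; apply: eqxx. Qed.

Lemma dfrac_eq_sym : symmetric dfrac_eq.
Proof. by move=> a b; apply: eq_sym. Qed.

Lemma dfrac_eq_trans : transitive dfrac_eq.
Proof.
move=> b a c; rewrite !dfrac_eq_le => /andP[ab ba] /andP[bc cb].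
by rewrite (dfrac_le_trans ab bc) (dfrac_le_trans cb ba).
Qed.

Canonical dfrac_equiv :=
  EquivRel dfrac_eq dfrac_eq_refl dfrac_eq_sym dfrac_eq_trans.

Definition divhull := {eq_quot dfrac_eq}.
HB.instance Definition _ : EqQuotient _ dfrac_eq divhull :=
  EqQuotient.on divhull.
HB.instance Definition _ := Choice.on divhull.

Definition divhull_le (u t : divhull) : bool := dfrac_le (repr u) (repr t).

Lemma dfrac_repr a : dfrac_eq (repr (\pi_divhull a)) a.
Proof. by apply/eqmodP; rewrite reprK. Qed.

Lemma divhull_leE a b :
  divhull_le (\pi_divhull a) (\pi_divhull b) = dfrac_le a b.
Proof.
have := dfrac_repr a; have := dfrac_repr b; rewrite /divhull_le.
rewrite !dfrac_eq_le => /andP[b1 b2] /andP[a1 a2].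
apply/idP/idP => le_ab.
  exact: dfrac_le_trans a2 (dfrac_le_trans le_ab b1).
exact: dfrac_le_trans a1 (dfrac_le_trans le_ab b2).
Qed.

Fact divhull_le_refl : reflexive divhull_le.
Proof. by move=> u; apply: dfrac_le_refl. Qed.

Fact divhull_le_anti : antisymmetric divhull_le.
Proof.
move=> u t; rewrite /divhull_le -dfrac_eq_le => eq_ut.
by rewrite -[u]reprK -[t]reprK; apply/eqmodP.
Qed.

Fact divhull_le_trans : transitive divhull_le.
Proof. by move=> t u s; apply: dfrac_le_trans. Qed.

Fact divhull_le_total : total divhull_le.
Proof. by move=> u t; apply: le_total. Qed.

HB.instance Definition _ := Order.Le_isPOrder.Build ring_display divhull
  divhull_le_refl divhull_le_anti divhull_le_trans.
HB.instance Definition _ :=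
  Order.POrder_isTotal.Build ring_display divhull divhull_le_total.

(* The element x / b, for b > 0. *)
Definition divhull_div (x : G) (b : nat) : divhull :=
  (\pi_divhull (x, b.-1 : nat)).

Lemma divhull_div_le (x y : G) (b c : nat) : (0 < b)%N -> (0 < c)%N ->
  (divhull_div x b <= divhull_div y c) = (x *+ c <= y *+ b).
Proof.
case: b c => [|b] [|c] // _ _.
exact: (divhull_leE (x, b : nat) (y, c : nat)).
Qed.

End DivisibleHull.

(* The value group is not required to be the whole of G. *)
Definition valuation (F : fieldType) (G : oagType) (v : F -> withtop G) : Prop :=
  [/\ forall x, v x = PInf <-> x = 0,
      forall x y, v (x * y) = withtop_add (v x) (v y)
    & forall x y, Num.min (v x) (v y) <= v (x + y)].

(* w, on an extension i : F -> E, restricts to v on F once G is identified    *)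
(* with an ordered subgroup of H.                                             *)
Definition extends (F E : fieldType) (i : F -> E) (G H : oagType)
    (v : F -> withtop G) (w : E -> withtop H) : Prop :=
  exists j : {additive G -> H},
    {mono j : x y / x <= y} /\ forall a, w (i a) = withtop_map j (v a).

(* v has a unique prolongation, up to equivalence, to every algebraic         *)
(* extension of F (a prolongation always exists).                             *)
Definition henselian (F : fieldType) (G : oagType) (v : F -> withtop G) : Prop :=
  forall (E : fieldType) (i : {rmorphism F -> E}) (H1 H2 : oagType)
         (u1 : E -> withtop H1) (u2 : E -> withtop H2),
    (forall x, algebraicOver i x) ->
    valuation u1 -> valuation u2 -> extends i v u1 -> extends i v u2 ->
    forall x y, (u1 x <= u1 y) = (u2 x <= u2 y).

Definition is_max d (T : porderType d) (A : set T) (m : T) : Prop :=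
  A m /\ ubound A m.
Definition is_min d (T : porderType d) (A : set T) (m : T) : Prop :=
  A m /\ lbound A m.

Definition pdeg (R : nzRingType) (f : {poly R}) : nat := (size f).-1.

Section KeyPolynomials.
Variables (K : fieldType) (G : oagType) (w : {fraction {poly K}} -> withtop G).
Implicit Types f g Q : {poly K}.

(* (w f - w (d_b f)) / b, which counts as -oo when d_b f = 0; f^`N(b) is      *)
(* (1 / b!) d^b f / dX^b.                                                     *)
Definition eps_slope f (b : nat) : withbot (divhull G) :=
  match w f%:F, w (f^`N(b))%:F with
  | Fin x, Fin y => FinB (divhull_div (x - y) b)
  | _, _ => NInf
  end.

(* Only b < size f need be considered, as f^`N(b) = 0 for b >= size f. *)
Definition eps f : withbot (divhull G) :=
  \big[Order.max/NInf]_(1 <= b < size f) eps_slope f b.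

Definition abkp Q : Prop :=
  [/\ Q \is monic, (0 < pdeg Q)%N
    & forall f, eps Q <= eps f -> (pdeg Q <= pdeg f)%N].

(* The i-th coefficient of the Q-expansion of f, see Qexpansion below. *)
Definition Qcoef Q f (i : nat) : {poly K} := (f %/ Q ^+ i) %% Q.

(* Qcoef Q f i = 0 for i >= size f when Q is not constant. *)
Definition truncation Q f : withtop G :=
  \big[Order.min/PInf]_(i < size f) w (Qcoef Q f i * Q ^+ i)%:F.

Definition alpha Q : withtop nat :=
  xget PInf [set n | exists2 m, n = Fin m &
    is_min [set pdeg f | f in [set f | truncation Q f < w f%:F]] m].

Definition psi Q : set {poly K} :=
  [set f | [/\ f \is monic, truncation Q f < w f%:F & Fin (pdeg f) = alpha Q]].

End KeyPolynomials.

Lemma Qexpansion (K : fieldType) (Q : {poly K}) :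
  Q \is monic -> (0 < pdeg Q)%N ->
  forall f : {poly K}, (forall i, size (Qcoef Q f i) < size Q)%N /\
    f = \sum_(i < size f) Qcoef Q f i * Q ^+ i.
Proof.
move=> Qmonic; rewrite /pdeg => Qgt0.
have Q0 : Q != 0 by apply: monic_neq0.
have Qsz : (1 < size Q)%N by case: (size Q) Qgt0 => [|[]].
move=> f; split=> [i|]; first by rewrite /Qcoef ltn_modp.
have H n : f = \sum_(i < n) Qcoef Q f i * Q ^+ i + (f %/ Q ^+ n) * Q ^+ n.
  elim: n => [|n IHn]; first by rewrite big_ord0 expr0 divp1 mulr1 add0r.
  rewrite big_ord_recr /= {1}IHn -addrA; congr (_ + _).
  by rewrite {1}(divp_eq (f %/ Q ^+ n) Q) mulrDl addrC divp_divl -exprSr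
             -mulrA -exprS.
rewrite {1}(H (size f)) divp_small ?mul0r ?addr0 //.
rewrite -(@prednK (size (Q ^+ _))) ?size_poly_gt0 ?expf_neq0 // size_exp ltnS.
exact: leq_pmull.
Qed.

Section DistinguishedPairs.
Variables (K : fieldType) (L : fieldType) (i : {rmorphism K -> L}).

Definition adjoin (theta : L) : set L :=
  [set x | exists p q : {poly K}, (map_poly i q).[theta] != 0 /\
     x = (map_poly i p).[theta] / (map_poly i q).[theta]].

Definition is_basis (V : set L) n (b : 'I_n -> L) : Prop :=
  (forall k, V (b k)) /\
  forall x, V x -> exists! c : 'rV[K]_n, x = \sum_k i (c 0 k) * b k.

(* The dimension [K(theta) : K] (0 if infinite). *)
Definition degree (theta : L) : nat :=
  xget 0%N [set n | exists b : 'I_n -> L, is_basis (adjoin theta) b].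

Variables (G : oagType) (vbar : L -> withtop G).

Definition distinguished_elts (theta alpha : L) : Prop :=
  [/\ (degree alpha < degree theta)%N,
      is_max [set vbar (theta - beta) |
                beta in [set beta | (degree beta < degree theta)%N]]
             (vbar (theta - alpha))
    & forall eta, (degree eta < degree alpha)%N ->
        vbar (theta - eta) < vbar (theta - alpha)].

Definition distinguished_pair (g f : {poly K}) : Prop :=
  [/\ irreducible_poly g, irreducible_poly f
    & exists theta alpha, [/\ root (map_poly i g) theta,
        root (map_poly i f) alpha & distinguished_elts theta alpha]].

Variables (H : oagType) (w : {fraction {poly K}} -> withtop H).

(* The chain (Q_r, ..., Q_0) is given by the restriction of s to [0, r]. *)
Definition saturated_distinguished_chain (Q : {poly K}) (r : nat)
    (s : nat -> {poly K}) : Prop :=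
  [/\ s r = Q, forall k, (k <= r)%N -> abkp w (s k),
      forall k, (1 <= k <= r)%N -> distinguished_pair (s k) (s k.-1)
    & pdeg (s 0%N) = 1%N].

End DistinguishedPairs.

(* Main.v *)
Require Import Defs.
From HB Require Import structures.
From mathcomp Require Import all_boot all_order all_algebra all_field.
From mathcomp Require Import boolp classical_sets zify ring.

Set Implicit Arguments.
Unset Strict Implicit.
Unset Printing Implicit Defensive.

Import Order.TTheory GRing.Theory.
Local Open Scope ring_scope.

(** Fix a valuation of the field E = Kbar(X) that extends both w and the
valuation of Kbar, still called w below, and attach to each nonconstant f over
K a root a_f for which w (X - a_f) is largest. Everything is governed by the
numbers delta(f) = w (X - a_f).

- Expanding f around X gives coefficients f^`N(b) that are, up to the leading
  coefficient of f, the elementary symmetric functions of the X - a for the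
  roots a of f. Reading this as a Newton polygon, eps f and delta(f) determine
  each other monotonically ([eps_le]). So Q is an abstract key polynomial
  exactly when no element b of degree smaller than deg Q satisfies w (X - b) >=
  delta(Q) ([abkp_far_roots] is the useful half); in particular Q is
  irreducible.
- For such a Q, the Q-truncation of w is the Gauss valuation centred at a_Q of
  radius delta(Q): it replaces the value of each X - b by its minimum with
  delta(Q). Hence w_Q f < w f if and only if f has a root b with w (X - b) >
  delta(Q) ([truncation_lt]).
- If w (X - b) < w (X - t), then w (t - b) = w (X - b). With t = a_Q', this
  computes w (t - b) for every b of degree less than deg Q'. It translates the
  condition that (t, a_Q) is a distinguished pair into the statement that Q'
  has minimal degree among the polynomials having a root closer to X than
  delta(Q), which is Q' in psi(Q) ([psi_distinguished], [distinguished_psi]).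
  The theorem follows by applying this to consecutive members of the chain.

A distinguished pair gives some root t of Q', perhaps not a_Q'. Conjugate
elements over the henselian field K have the same value ([conjugate_value_eq]),
hence so do the Taylor coefficients at t and at a_Q' of any polynomial over K,
and these coefficients determine how near t or a_Q' is to its roots
([near_root_conjugate]).

The valuation of E is obtained from Zorn's lemma ([extend_value_order]); that
it induces the given valuation on Kbar is again the henselian property
([henselian_order]). Only comparisons of values ever matter, so a valuation is
handled through the preorder it induces, and the number delta(f) through the
element X - a_f; this avoids building value groups for the extensions. *)

(** * Valuations up to equivalence *)

Lemma ex_extremum (T : eqType) (r : rel T) (s : seq T) :
  total r -> transitive r -> s != [::] ->
  exists2 x, x \in s & {in s, forall y, r x y}.
Proof.
move=> rt rtr; have rr x : r x x by have := rt x x; rewrite orbb.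
elim: s => // x [|y s] IHs _; first by exists x; rewrite ?mem_head // => y;
  rewrite inE => /eqP ->.
have [//|z zs zmin] := IHs; have /orP[xz|zx] := rt x z.
  exists x; rewrite ?mem_head // => t; rewrite inE => /predU1P[-> //|/zmin].
  exact: rtr xz.
exists z; first by rewrite inE zs orbT.
by move=> t; rewrite inE => /predU1P[->|/zmin].
Qed.

(** A valuation up to equivalence: le x y says that the value of x is at most
the value of y, so that 0 is the largest element. *)
Record value_order (R : idomainType) (le : rel R) : Prop := ValueOrder {
  vo_total : total le;
  vo_trans : transitive le;
  vo_mul : forall z x y, z != 0 -> le (z * x) (z * y) = le x y;
  vo_add : forall x y z, le x y -> le x z -> le x (y + z);
  vo_le0 : forall x, le 0 x -> x = 0
}.

Section ValueOrderTheory.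
Variables (R : idomainType) (le : rel R).
Hypothesis vo : value_order le.
Implicit Types x y z d : R.

Local Notation "x <=v y" := (le x y) (at level 70).
Local Notation "x <v y" := (~~ le y x) (at level 70).

Lemma vle_refl x : x <=v x.
Proof. by have := vo_total vo x x; rewrite orbb. Qed.
Hint Resolve vle_refl : core.

Lemma vle_trans y x z : x <=v y -> y <=v z -> x <=v z.
Proof. exact: vo_trans vo _ _ _. Qed.

Lemma vltW x y : x <v y -> x <=v y.
Proof. by have /orP[->|->] := vo_total vo x y. Qed.

Lemma vle_lt_trans y x z : x <=v y -> y <v z -> x <v z.
Proof. by move=> xy; apply: contra => zx; apply: vle_trans xy. Qed.

Lemma vlt_le_trans y x z : x <v y -> y <=v z -> x <v z.
Proof. by move=> xy yz; apply: contra xy; apply: vle_trans. Qed.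

Lemma vle0 x : x <=v 0.
Proof. by have /orP[//|h] := vo_total vo x 0; rewrite (vo_le0 vo h). Qed.

Lemma vlt0 x : x != 0 -> x <v 0.
Proof. by apply: contraNN => /(vo_le0 vo) ->. Qed.

Lemma vlt_neq0 x y : x <v y -> x != 0.
Proof. by apply: contraNneq => ->; apply: vle0. Qed.

Lemma vle_mul x x' y y' : x <=v y -> x' <=v y' -> x * x' <=v y * y'.
Proof.
move=> xy xy'; have [->|y0] := eqVneq y 0; first by rewrite mul0r vle0.
apply: (@vle_trans (y * x')); last by rewrite vo_mul.
have [->|x0'] := eqVneq x' 0; first by rewrite !mulr0.
by rewrite ![_ * x']mulrC vo_mul.
Qed.

Lemma vlt_mul x x' y y' : x != 0 -> x <=v y -> x' <v y' -> x * x' <v y * y'.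
Proof.
move=> x0 xy xy'; apply: (@vlt_le_trans (x * y')); first by rewrite vo_mul.
exact: vle_mul.
Qed.

Lemma vle_exp n x y : x <=v y -> x ^+ n <=v y ^+ n.
Proof.
by move=> xy; elim: n => [//|n IHn]; rewrite !exprS; apply: vle_mul.
Qed.

Lemma vlt_exp n x y : x <v y -> x ^+ n.+1 <v y ^+ n.+1.
Proof.
move=> xy; have x0 := vlt_neq0 xy; elim: n => [//|n IHn];
  rewrite ![_ ^+ n.+2]exprS.
by apply: vlt_mul => //; apply: vltW.
Qed.

Lemma vle_exp2 n x y : (0 < n)%N -> (x ^+ n <=v y ^+ n) = (x <=v y).
Proof.
case: n => // n _; apply/idP/idP; last exact: vle_exp.
by apply: contraLR => /vlt_exp; apply.
Qed.

Lemma vle_sum (I : Type) (r : seq I) (P : pred I) (F : I -> R) x :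
  (forall i, P i -> x <=v F i) -> x <=v \sum_(i <- r | P i) F i.
Proof. by move=> h; elim/big_rec: _ => [|i y Pi]; [apply: vle0|apply: vo_add =>
  //; apply: h]. Qed.

Lemma vlt_add x y z : x <v y -> x <v z -> x <v y + z.
Proof.
move=> xy xz; have /orP[yz|zy] := vo_total vo y z.
  by apply: vlt_le_trans xy _; apply: vo_add.
by apply: vlt_le_trans xz _; apply: vo_add.
Qed.

Lemma vlt_sum (I : Type) (r : seq I) (P : pred I) (F : I -> R) x : x != 0 ->
  (forall i, P i -> x <v F i) -> x <v \sum_(i <- r | P i) F i.
Proof.
by move=> x0 h; elim/big_rec: _ => [|i y Pi]; [apply: vlt0|apply: vlt_add => //;
  apply: h].
Qed.

Lemma vle_oppr x y : (x <=v - y) = (x <=v y).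
Proof.
have h1 : le (1 : R) (-1).
  have /orP[//|h] := vo_total vo 1 (-1 : R).
  by have := vle_mul (vle_refl (-1)) h; rewrite mulrNN !mulr1.
have hN z : z <=v - z by rewrite -[X in le X]mulr1 -mulrN1 vle_mul.
apply/idP/idP => h; apply: vle_trans h _; last exact: hN.
by rewrite -[X in le _ X]opprK; apply: hN.
Qed.

Lemma vle_oppl x y : (- x <=v y) = (x <=v y).
Proof.
by apply/idP/idP; apply: vle_trans; rewrite ?vle_oppr // -vle_oppr.
Qed.

Lemma vle_sub x y z : x <=v y -> x <=v z -> x <=v y - z.
Proof. by move=> xy xz; apply: vo_add => //; rewrite vle_oppr. Qed.

(** Otherwise x = (x + y) - y would have a value larger than its own. *)
Lemma vlt_addl x y : x <v y -> x + y <=v x.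
Proof.
move=> xy; have [//|h] := boolP (x + y <=v x); exfalso.
have : x <v (x + y) - y by apply: vlt_add => //; rewrite vle_oppl.
by rewrite addrK vle_refl.
Qed.

Lemma vlt_subl y d : y <v d -> y - d <=v y /\ y <=v y - d.
Proof.
move=> yd; split; first by apply: vlt_addl; rewrite vle_oppl.
by apply: vle_sub; [apply: vle_refl|apply: vltW].
Qed.

Lemma vle_prod (I : eqType) (r : seq I) (F G : I -> R) :
  {in r, forall i, F i <=v G i} ->
  \prod_(i <- r) F i <=v \prod_(i <- r) G i.
Proof.
move=> h; rewrite !big_seq; elim/big_rec2: _ => [|i y x /h le_i].
  exact: vle_refl.
exact: vle_mul.
Qed.

Lemma vlt_prod (I : eqType) (r : seq I) (F G : I -> R) :
    {in r, forall i, F i != 0} -> {in r, forall i, F i <=v G i} ->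
  (\prod_(i <- r) F i <v \prod_(i <- r) G i) = has (fun i => F i <v G i) r.
Proof.
elim: r => [|i r IHr] F0 FG; first by rewrite !big_nil vle_refl.
have F0i := F0 i (mem_head i r); have FGi := FG i (mem_head i r).
have F0r : {in r, forall i, F i != 0} by move=> j jr; rewrite F0 // inE jr orbT.
have FGr : {in r, forall i, F i <=v G i} by move=> j jr;
  rewrite FG // inE jr orbT.
rewrite !big_cons /= -IHr //; have [GF|FGlt] := boolP (G i <=v F i) => /=.
  congr negb; apply/idP/idP => h; last exact: vle_mul.
  rewrite -(vo_mul vo _ _ F0i); apply: vle_trans h.
  by apply: vle_mul => //; apply: vle_refl.
rewrite (mulrC (F i)) (mulrC (G i)); apply: vlt_mul => //; last exact: vle_prod.
by rewrite prodf_seq_neq0; apply/allP.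
Qed.

(** * Polynomials with a dominant term *)

Definition vmin d c := if d <=v c then d else c.

Lemma vmin_neq0 d c : d != 0 -> vmin d c != 0.
Proof. by move=> d0; rewrite /vmin; case: ifPn => // /vlt_neq0. Qed.

(** The Gauss value of P, the minimum of the values of its coefficients, is
that of m, and N is the last exponent where it is attained. Recording the last
exponent makes the notion additive in N under products, and lets terms with
different N never cancel in a sum. *)
Definition dominant (P : {poly R}) (m : R) (N : nat) : Prop :=
  [/\ m != 0, P`_N <=v m, forall b, m <=v P`_b
    & forall b, (N < b)%N -> m <v P`_b].

(** Gauss's lemma: in the coefficient of exponent N + N' all terms but one have
a value larger than that of m * m'. *)
Lemma dominant_mul P P' m m' N N' :
  dominant P m N -> dominant P' m' N' -> dominant (P * P') (m * m') (N + N').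
Proof.
move=> [m0 PN mP ltP] [m0' PN' mP' ltP'].
have mm0 : m * m' != 0 by apply: mulf_neq0.
have lt j l : (N < j)%N || (N' < l)%N -> m * m' <v P`_j * P'`_l.
  case/orP => [/ltP h|/ltP' h]; last exact: vlt_mul.
  by rewrite (mulrC m) (mulrC P`_j); apply: vlt_mul.
split=> // [|b|b ltb]; rewrite coefM.
- have hN : (N < (N + N').+1)%N by rewrite ltnS leq_addr.
  rewrite (bigD1 (Ordinal hN)) //= addKn.
  set s := \sum_(_ < _ | _) _.
  have slt : m * m' <v s.
    apply: vlt_sum => // j; rewrite -val_eqE /= => jN; apply: lt.
    by have := ltn_ord j; move: jN; rewrite neq_ltn; lia.
  apply: vle_trans (vle_mul PN PN').
  by apply: vlt_addl; apply: vle_lt_trans slt; apply: vle_mul.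
- by apply: vle_sum => j _; apply: vle_mul.
- by apply: vlt_sum => // j _; apply: lt; have := ltn_ord j; lia.
Qed.

(** For this linear polynomial N is 1 or 0 according to the comparison of d and
c; the boolean is used as that number. *)
Lemma dominant_lin d c : d != 0 ->
  dominant (d *: 'X + c%:P) (vmin d c) (d <=v c).
Proof.
move=> d0; have cf b :
  (d *: 'X + c%:P)`_b = if b == 0%N then c else if b == 1%N then d else 0.
  rewrite coefD coefZ coefX coefC; case: b => [|[|b]] /=.
  - by rewrite mulr0 add0r.
  - by rewrite mulr1 addr0.
  - by rewrite mulr0 addr0.
rewrite /vmin; case: ifPn => dc; split => //=; rewrite ?cf //.
- by case=> [|[|b]]; rewrite cf //= vle0.
- by case=> [|[|b]] // _; rewrite cf vlt0.
- exact: vlt_neq0 dc.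
- by case=> [|[|b]]; rewrite cf //=; [apply: vltW|apply: vle0].
- by case=> [|[|b]] // _; rewrite cf // vlt0 // (vlt_neq0 dc).
Qed.

Lemma dominant_const k : k != 0 -> dominant k%:P k 0.
Proof.
move=> k0; split=> // [|b|b]; rewrite coefC //; first by case: ifP;
  rewrite ?vle_refl ?vle0.
by case: b => //= b _; apply: vlt0.
Qed.

Lemma dominant_exp P m N n : dominant P m N ->
  dominant (P ^+ n) (m ^+ n) (n * N).
Proof.
move=> h; elim: n => [|n IHn]; first by rewrite !expr0 mul0n;
  apply: dominant_const (oner_neq0 _).
by rewrite !exprS mulSn; apply: dominant_mul.
Qed.

Lemma dominant_add P P' m m' N N' :
  dominant P m N -> dominant P' m' N' -> (N < N')%N ->
  dominant (P + P') (vmin m' m) (if m' <=v m then N' else N).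
Proof.
move=> [m0 PN mP ltP] [m0' PN' mP' ltP'] NN; rewrite /vmin.
case: ifPn => mm; split=> // [|b|b ltb]; rewrite coefD.
- have lt : m' <v P`_N' by apply: vle_lt_trans mm _; apply: ltP.
  apply: (vle_trans _ PN'); rewrite addrC; apply: vlt_addl.
  exact: vle_lt_trans PN' lt.
- by apply: vo_add => //; apply: vle_trans mm _.
- apply: vlt_add; last exact: ltP'.
  by apply: vle_lt_trans mm _; apply: ltP; apply: ltn_trans ltb.
- apply: (vle_trans _ PN); apply: vlt_addl.
  exact: vle_lt_trans PN (vlt_le_trans mm _).
- by apply: vo_add => //; apply: vle_trans (vltW mm) _.
- by apply: vlt_add; [apply: ltP|apply: vlt_le_trans mm _].
Qed.

Lemma dominant_prod (s : seq R) d : d != 0 ->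
  dominant (\prod_(c <- s) (d *: 'X + c%:P)) (\prod_(c <- s) vmin d c)
    (count (le d) s).
Proof.
move=> d0; elim: s => [|c s IHs]; first by rewrite !big_nil;
  apply: dominant_const (oner_neq0 _).
by rewrite !big_cons /=; apply: dominant_mul => //; apply: dominant_lin.
Qed.

(** * Distance to the roots of a polynomial *)

(** The substitution Y -> z + d Y turns the Gauss valuation with centre z and
radius the value of d into the one with centre 0 and radius 0. *)
Definition rescale (f : {poly R}) z d : {poly R} := f \Po (d *: 'X + z%:P).

Lemma coef_rescale f z d b : (rescale f z d)`_b = f^`N(b).[z] * d ^+ b.
Proof.
rewrite /rescale addrC /comp_poly nderiv_taylor; last exact: mulrC.
rewrite size_map_polyC.
under eq_bigr => j _ do
  rewrite nderivn_map horner_map /= exprZn -scalerAr mul_polyC scalerA.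
rewrite coef_sumMXn.
have [ltb|leb] := ltnP b (size f).
  rewrite (big_pred1 (Ordinal ltb)) ?[_ * d ^+ _]mulrC // => j.
rewrite nderivn_poly0 // horner0 mul0r big_pred0 // => j.
by apply: contra_leqF leb => /eqP <-.
Qed.

Lemma rescale_split k (s : seq R) z d :
  rescale (k *: \prod_(a <- s) ('X - a%:P)) z d =
  k *: \prod_(a <- s) (d *: 'X + (z - a)%:P).
Proof.
rewrite /rescale comp_polyZ rmorph_prod /=; congr (_ *: _); apply: eq_bigr =>
  a _.
by rewrite comp_polyB comp_polyX comp_polyC rmorphB /= addrA.
Qed.

(** The number of roots in the ball of centre z and radius the value of d is
the N of the rescaled polynomial, since each factor becomes d Y + (z - a). *)
Lemma dominant_rescale k (s : seq R) z d : k != 0 -> d != 0 ->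
  dominant (rescale (k *: \prod_(a <- s) ('X - a%:P)) z d)
    (k * \prod_(a <- s) vmin d (z - a)) (count (fun a => d <=v z - a) s).
Proof.
move=> k0 d0; rewrite rescale_split -mul_polyC -[count _ _]add0n.
apply: dominant_mul; first exact: dominant_const.
have := dominant_prod [seq z - a | a <- s] d0.
by rewrite !big_map count_map.
Qed.

(** Some root lies in the ball of radius d around z when N > 0 for the rescaled
polynomial, that is unless its constant term f.[z] has strictly the smallest
value. The criterion mentions f only through its Taylor coefficients at z. *)
Lemma near_root_deriv k (s : seq R) z d f : k != 0 -> d != 0 ->
    f = k *: \prod_(a <- s) ('X - a%:P) ->
  (has (fun a => d <=v z - a) s) <->
  (exists2 b, (0 < b)%N & f^`N(b).[z] * d ^+ b <=v f.[z]).
Proof.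
move=> k0 d0 ->; have [] := dominant_rescale s z k0 d0.
set m := k * _; set N := count _ _; set g := k *: _ => m0 Nm mle mlt.
have cf0 : (rescale g z d)`_0 = g.[z] by rewrite coef_rescale nderivn0 mulr1.
rewrite has_count; split=> [N0|[b b0 hb]].
  by exists N => //; rewrite -coef_rescale; apply: vle_trans Nm _; rewrite -cf0.
have [N0|//] := posnP N.
have := mlt b; rewrite N0 b0 => /(_ isT)/negP[].
by rewrite coef_rescale; apply: vle_trans hb _; rewrite -cf0 -N0.
Qed.

(** When the radius is the distance from z to its nearest root, the constant
term of the rescaled polynomial still attains the minimum, together with a term
of positive exponent: the Newton polygon of f at z starts with slope the value
of z - a0. *)
Lemma nearest_root_deriv k (s : seq R) z a0 f : k != 0 -> z - a0 != 0 ->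
    f = k *: \prod_(a <- s) ('X - a%:P) -> a0 \in s ->
    (forall a, a \in s -> z - a <=v z - a0) ->
  (forall b, f.[z] <=v f^`N(b).[z] * (z - a0) ^+ b) /\
  exists2 N, (0 < N)%N & f^`N(N).[z] * (z - a0) ^+ N <=v f.[z].
Proof.
move=> k0 d0 fE a0s max; split=> [b|].
  have [] := dominant_rescale s z k0 d0; rewrite -fE.
  set m := k * _ => m0 _ mle _; apply: (@vle_trans m);
    last by rewrite -coef_rescale.
  rewrite fE hornerZ horner_prod; apply: vle_mul; first exact: vle_refl.
  apply: vle_prod => a /max le_a; rewrite !hornerE /vmin.
  by case: ifP => // _; apply: vle_refl.
apply/(near_root_deriv z k0 d0 fE).
by apply/hasP; exists a0 => //; apply: vle_refl.
Qed.

(** With y = z - a and d = z - a0 the element y - d is a0 - a, so that the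
value of a linear factor for the Gauss valuation centred at a0 is the minimum
of the values of z - a and d. *)
Lemma vmin_sub d y : (vmin d (y - d) <v y) = (d <v y) /\ vmin d (y - d) <=v y.
Proof.
rewrite /vmin; have [dy|yd] := boolP (d <=v y).
  rewrite ifT ?vle_sub ?vle_refl //.
have [le1 le2] := vlt_subl yd.
by rewrite ifN; [rewrite le2 le1 vltW|apply: vle_lt_trans le1 _].
Qed.

(** The left factor is the Gauss value, with centre a0 and radius the value of
z - a0, of the polynomial with roots s and leading coefficient k; the right one
is its value at z. *)
Lemma vmin_prod_lt (s : seq R) z a0 k : k != 0 -> z - a0 != 0 ->
  (k * \prod_(a <- s) vmin (z - a0) (a0 - a) <v k * \prod_(a <- s) (z - a))
  = has (fun a => z - a0 <v z - a) s.
Proof.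
move=> k0 d0; rewrite vo_mul //.
have E a : a0 - a = (z - a) - (z - a0) by ring.
rewrite vlt_prod => [|a _|a _]; last by rewrite E; have [] :=
  vmin_sub (z - a0) (z - a).
  by apply: eq_has => a; rewrite E; have [] := vmin_sub (z - a0) (z - a).
exact: vmin_neq0.
Qed.

End ValueOrderTheory.

(** * Extending a valuation to a larger field *)

Section Chevalley.
Variables (D : idomainType) (E : fieldType) (f : {rmorphism D -> E}).
Hypothesis f_inj : injective f.
Variable (le : rel D).
Hypothesis vo : value_order le.

Definition subring_set (B : set E) : Prop :=
  [/\ B 1, forall x y, B x -> B y -> B (x - y)
    & forall x y, B x -> B y -> B (x * y)].

Lemma subring0 B : subring_set B -> B 0.
Proof. by move=> [B1 BB _]; rewrite -(subrr 1); apply: BB. Qed.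

Lemma subringN B x : subring_set B -> B x -> B (- x).
Proof. by move=> hB Bx; rewrite -sub0r; have [_ BB _] := hB; apply: BB => //;
  apply: subring0. Qed.

Lemma subringD B x y : subring_set B -> B x -> B y -> B (x + y).
Proof.
by move=> hB Bx By; rewrite -(opprK y); have [_ BB _] := hB; apply: BB => //;
  apply: subringN.
Qed.

Lemma subringX B x n : subring_set B -> B x -> B (x ^+ n).
Proof.
move=> [B1 _ BM] Bx; elim: n => [|n IHn]; first by rewrite expr0.
by rewrite exprS; apply: BM.
Qed.

(** The valuation ring of the fraction field of f(D) inside E. *)
Definition base_ring : set E :=
  [set x | exists p q, [/\ q != 0, le q p & x = f p / f q]].

(** The last two conditions say that B meets the fraction field of f(D) in its
valuation ring. *)
Definition lies_over (B : set E) : Prop :=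
  [/\ subring_set B, (base_ring `<=` B)%classic
    & forall p q, q != 0 -> B (f p / f q) -> le q p].

Let f_neq0 p : (f p != 0) = (p != 0).
Proof. by rewrite -(inj_eq f_inj) rmorph0. Qed.

Lemma base_ring_lies_over : lies_over base_ring.
Proof.
split=> //.
- split.
  + by exists 1, 1; rewrite oner_neq0 (vle_refl vo) divff // rmorph1 oner_neq0.
  + move=> _ _ [p [q [q0 qp ->]]] [p' [q' [q0' qp' ->]]].
    exists (p * q' - p' * q), (q * q'); split; first exact: mulf_neq0.
      apply: (vle_sub vo); last rewrite mulrC.
        by apply: (vle_mul vo) => //; apply: (vle_refl vo).
      by apply: (vle_mul vo) => //; apply: (vle_refl vo).
    rewrite rmorphB !rmorphM; field; by rewrite !f_neq0 q0 q0'.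
  + move=> _ _ [p [q [q0 qp ->]]] [p' [q' [q0' qp' ->]]].
    exists (p * p'), (q * q'); split; [exact: mulf_neq0|exact: (vle_mul vo)|].
    rewrite !rmorphM; field; by rewrite !f_neq0 q0 q0'.
- move=> p q q0 [p' [q' [q0' qp' e]]].
  have e' : p * q' = p' * q.
    apply: f_inj; rewrite !rmorphM; apply/eqP; rewrite -eqr_div ?f_neq0 //.
    exact/eqP.
  by rewrite -(vo_mul vo _ _ q0') (mulrC q' p) e' (mulrC q') (mulrC p') vo_mul.
Qed.

(** Zorn's lemma needs an upper bound for the empty chain also, hence the
detour through a family that contains the empty set. *)
Lemma ex_maximal_lying_over : exists2 B, lies_over B &
  forall B', lies_over B' -> (B `<=` B')%classic -> (B' `<=` B)%classic.
Proof.
have [|B [PB maxB]] := @Zorn_bigcup E [set B | B = set0 \/ lies_over B].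
  move=> F FP tot; have [F0|nF0] := pselect (forall X, F X -> X = set0).
    left; rewrite -subset0 => x [X FX Xx]; by rewrite (F0 X FX) in Xx.
  right; have [X0 FX0 X0nz] : exists2 X, F X & X <> set0.
    by apply: contrapT => h; apply: nF0 => X FX; apply: contrapT => X0;
      apply: h; exists X.
  have FL X x : F X -> X x -> lies_over X.
    by move=> FX Xx; have [X0'|//] := FP X FX; rewrite X0' in Xx.
  have X0L : lies_over X0 by have [|] := FP X0 FX0.
  have common x y : (\bigcup_(X in F) X)%classic x ->
    (\bigcup_(X in F) X)%classic y ->
    exists X, [/\ F X, X x & X y].
    move=> [X FX Xx] [Y FY Yy]; have [XY|YX] := tot X Y FX FY.
      by exists Y; split=> //; apply: XY.
    by exists X; split=> //; apply: YX.
  split; first split.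
  - by exists X0 => //; have [[]] := X0L.
  - move=> x y hx hy; have [X [FX Xx Xy]] := common x y hx hy; exists X => //.
    by have [[_ BB _] _ _] := FL X x FX Xx; apply: BB.
  - move=> x y hx hy; have [X [FX Xx Xy]] := common x y hx hy; exists X => //.
    by have [[_ _ BM] _ _] := FL X x FX Xx; apply: BM.
  - by move=> x bx; exists X0 => //; have [_ h _] := X0L; apply: h.
  - by move=> p q q0 [X FX Xx]; have [_ _] := FL X _ FX Xx; apply.
have {}PB : lies_over B.
  case: PB => // B0; exfalso; apply: (maxB base_ring); last by right;
    exact: base_ring_lies_over.
  rewrite B0; split=> // h; have [[h1 _ _] _ _] := base_ring_lies_over.
  exact: (h _ h1).
exists B => // B' hB' BB' x B'x; apply: contrapT => nBx.
by apply: (maxB B'); [split=> // h; apply: nBx; apply: h|right].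
Qed.

Section MaximalRing.
Variable B : set E.
Hypothesis LB : lies_over B.
Hypothesis maxB :
  forall B', lies_over B' -> (B `<=` B')%classic -> (B' `<=` B)%classic.

Let subB : subring_set B. Proof. by case: LB. Qed.
Let B0 : B 0. Proof. exact: subring0. Qed.
Let B1 : B 1. Proof. by case: subB. Qed.
Let BM x y : B x -> B y -> B (x * y). Proof. by case: subB => _ _; apply. Qed.

(** The ideal of B generated by the elements of base_ring of positive value. *)
Definition pos_ideal (c : E) : Prop :=
  exists p q b, [/\ ~~ le q p, B b & c = f q / f p * b].

Lemma pos_idealM b c : B b -> pos_ideal c -> pos_ideal (b * c).
Proof.
move=> Bb [p [q [b' [pq Bb' ->]]]]; exists p, q, (b * b'); split=> //;
  first exact: BM.
by ring.
Qed.

Lemma pos_idealB b : pos_ideal b -> B b.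
Proof.
move=> [p [q [b' [pq Bb' ->]]]]; apply: BM => //; have [_ h _] := LB; apply: h.
by exists q, p; split=> //; [apply: (vlt_neq0 vo pq)|apply: (vltW vo pq)].
Qed.

(** Of two generators one divides the other in base_ring, so that a sum of two
multiples of generators is again a multiple of one generator. *)
Lemma pos_idealD c c' : pos_ideal c -> pos_ideal c' -> pos_ideal (c + c').
Proof.
move=> [p [q [b [pq Bb ->]]]] [p' [q' [b' [pq' Bb' ->]]]].
have p0 := vlt_neq0 vo pq; have p0' := vlt_neq0 vo pq'.
wlog h : p q b p' q' b' pq Bb pq' Bb' p0 p0' / le (q * p') (q' * p).
  move=> W; have /orP[h|h] := vo_total vo (q * p') (q' * p); first exact: W h.
  by rewrite addrC; apply: W h.
have [q0|q0] := eqVneq q 0.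
  have q0' : q' = 0.
    move: h; rewrite q0 mul0r => /(vo_le0 vo)/eqP.
    by rewrite mulf_eq0 (negbTE p0) orbF => /eqP.
  exists p, q, b; split=> //; rewrite q0 q0' rmorph0; ring.
exists p, q, (b + f (q' * p) / f (q * p') * b'); split=> //.
  apply: subringD => //; apply: BM => //; have [_ H _] := LB; apply: H.
  by exists (q' * p), (q * p'); split=> //; apply: mulf_neq0.
rewrite !rmorphM; field; by rewrite !f_neq0 p0 q0 p0'.
Qed.

Lemma pos_ideal_proper : ~ pos_ideal 1.
Proof.
move=> [p [q [b [pq Bb e]]]]; have p0 := vlt_neq0 vo pq.
have q0 : q != 0.
  by apply: contraTneq (oner_neq0 E) => q0; rewrite e q0 rmorph0 !mul0r eqxx.
have eb : b = f p / f q.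
  apply: (mulfI (x := f q / f p)).
    by rewrite mulf_neq0 ?invr_eq0 ?f_neq0.
  by rewrite -e; field; rewrite !f_neq0 p0 q0.
have [_ _ h] := LB; move: pq; rewrite h // -?eb //.
Qed.

Lemma pos_ideal0 : pos_ideal 0.
Proof.
exists 1, 0, 0; split=> //; first by rewrite (vlt0 vo) ?oner_neq0.
by rewrite mulr0.
Qed.

(** Inverting 1 - c gives a ring that still lies over the base ring: if it
contained the inverse of an element of positive value, some power of 1 - c
would be in the proper ideal pos_ideal, and hence so would 1. *)
Lemma unit_1sub c : pos_ideal c -> B (1 - c)^-1.
Proof.
move=> Jc; have [_ _ B_le] := LB; have [_ baseB _] := LB.
have Bs : B (1 - c) by have [_ BB _] := subB; apply: BB => //;
  apply: pos_idealB.
have s0 : 1 - c != 0.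
  apply/eqP => /eqP; rewrite subr_eq0 => /eqP e; apply: pos_ideal_proper.
  by rewrite e.
have sX n : exists2 c', pos_ideal c' & (1 - c) ^+ n = 1 - c'.
  elim: n => [|n [c' Jc' IHn]].
    by exists 0; [exact: pos_ideal0|rewrite expr0 subr0].
  exists (c + (1 - c) * c'); last by rewrite exprS IHn; ring.
  by apply: pos_idealD => //; apply: pos_idealM.
pose B' := [set x | exists2 n, True & B (x * (1 - c) ^+ n)]%classic.
apply: (maxB (B' := B')); last 2 first.
- by move=> x Bx; exists 0%N => //; rewrite mulr1.
- by exists 1%N => //; rewrite expr1 mulVf.
have Bsn n : B ((1 - c) ^+ n) by apply: subringX.
split; first split.
- by exists 0%N => //; rewrite mulr1.
- move=> x y [n _ Bx] [m _ By]; exists (n + m)%N => //.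
  have -> : (x - y) * (1 - c) ^+ (n + m) = x * (1 - c) ^+ n * (1 - c) ^+ m
      - y * (1 - c) ^+ m * (1 - c) ^+ n by rewrite exprD; ring.
  by have [_ BB _] := subB; apply: BB; apply: BM.
- move=> x y [n _ Bx] [m _ By]; exists (n + m)%N => //.
  have -> : (x * y) * (1 - c) ^+ (n + m) = x * (1 - c) ^+ n * (y * (1 - c) ^+ m)
    by rewrite exprD; ring.
  exact: BM.
- by move=> x /baseB Bx; exists 0%N => //; rewrite mulr1.
- move=> p q q0 [n _ Bx]; apply: contrapT => /negP pq.
  have p0 := vlt_neq0 vo pq; have [c' Jc' e] := sX n.
  apply: pos_ideal_proper; rewrite -(subrK c' 1) -e; apply: pos_idealD => //.
  exists p, q, (f p / f q * (1 - c) ^+ n); split=> //.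
  field; by rewrite !f_neq0 p0 q0.
Qed.

(** By maximality B[x] contains the inverse of an element of positive value of
the base ring. *)
Lemma ex_unit_relation x : ~ B x ->
  exists2 g : {poly E}, (forall k, pos_ideal g`_k) & g.[x] = 1.
Proof.
move=> nBx; have [_ baseB _] := LB.
pose B' := [set y |
  exists2 g : {poly E}, (forall k, B g`_k) & g.[x] = y]%classic.
have BC c : B c -> forall k, B (c%:P)`_k by move=> Bc k; rewrite coefC;
  case: ifP.
have nL : ~ lies_over B'.
  move=> LB'; apply: nBx; apply: (maxB LB').
    by move=> y By; exists y%:P; [apply: BC|rewrite hornerC].
  by exists 'X; [move=> k; rewrite coefX; case: (k == 1%N)|rewrite hornerX].
apply: contrapT => nG; apply: nL; split; first split.
- by exists 1%:P; [apply: BC|rewrite hornerC].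
- move=> _ _ [g Bg <-] [h Bh <-]; exists (g - h); last by rewrite !hornerE.
  by move=> k; rewrite coefB; have [_ BB _] := subB; apply: BB.
- move=> _ _ [g Bg <-] [h Bh <-]; exists (g * h); last by rewrite !hornerE.
  move=> k; rewrite coefM; elim/big_rec: _ => // j y _ By.
  by apply: subringD => //; apply: BM.
- by move=> y /baseB By; exists y%:P; [apply: BC|rewrite hornerC].
- move=> p q q0 [g Bg e]; apply: contrapT => /negP pq; apply: nG.
  have p0 := vlt_neq0 vo pq; exists ((f q / f p) *: g).
    by move=> k; rewrite coefZ; exists p, q, g`_k.
  by rewrite hornerZ e; field; rewrite !f_neq0 p0 q0.
Qed.

(** The relation h shows that x ^+ n is a combination, with coefficients in the
ideal, of smaller powers of x; substituting it for the leading power in the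
relation g lowers the degree of g. *)
Lemma shorten_unit_relation x (g h : {poly E}) : x != 0 ->
    (forall k, pos_ideal g`_k) -> g.[x] = 1 ->
    (forall k, pos_ideal h`_k) -> h.[x^-1] = 1 -> (size h <= size g)%N ->
  exists g' : {poly E}, [/\ forall k, pos_ideal g'`_k, g'.[x] = 1
    & (size g' < size g)%N].
Proof.
move=> x0 Jg gx Jh hx le_hg.
have g0 : g != 0 by apply: contra_eq_neq gx => ->;
  rewrite horner0 eq_sym oner_neq0.
have [n sg] : exists n, size g = n.+1.
  by case: (size g) (size_poly_eq0 g) g0 => [<-//|n] _ _; exists n.
pose u := (1 - h`_0)^-1; have Bu : B u by apply: unit_1sub.
have u1 : u * (1 - h`_0) = 1.
  rewrite mulVf // subr_eq0; apply/eqP => e; apply: pos_ideal_proper.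
  by rewrite e.
(* The term g`_n x ^+ n is rewritten as the sum over j > 0 of
   g`_n u h`_j x ^+ (n - j); its coefficient of exponent k has j = n - k. *)
exists (\poly_(k < n) (g`_k + g`_n * u * h`_(n - k))); split.
- move=> k; rewrite coef_poly; case: ifP => _; last exact: pos_ideal0.
  apply: pos_idealD => //; apply: pos_idealM => //; apply: BM => //.
  exact: pos_idealB.
- rewrite horner_poly; under eq_bigr => k _ do rewrite mulrDl.
  rewrite big_split /=.
  have -> : \sum_(k < n) g`_n * u * h`_(n - k) * x ^+ k = g`_n * x ^+ n.
    have -> : \sum_(k < n) g`_n * u * h`_(n - k) * x ^+ k =
       g`_n * u * x ^+ n * \sum_(k < n) h`_k.+1 * x^-1 ^+ k.+1.
      rewrite mulr_sumr (reindex_inj rev_ord_inj) /=; apply: eq_bigr => k _.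
      have -> : (n - (n - k.+1) = k.+1)%N by have := ltn_ord k; lia.
      have -> : x ^+ n = x ^+ (n - k.+1) * x ^+ k.+1.
        by rewrite -exprD; congr (_ ^+ _); have := ltn_ord k; lia.
      rewrite exprVn; field; exact: expf_neq0.
    have -> : \sum_(k < n) h`_k.+1 * x^-1 ^+ k.+1 = 1 - h`_0.
      rewrite -hx; rewrite sg in le_hg.
      rewrite (horner_coef_wide _ le_hg) big_ord_recl.
      by rewrite expr0 mulr1 addrC addKr.
    by rewrite -!mulrA [x ^+ n * _]mulrC (mulrA u) u1 mul1r.
  by rewrite -gx horner_coef sg big_ord_recr.
- by rewrite sg ltnS size_poly.
Qed.

(** Otherwise there are relations for x and for its inverse, and the longer of
the two can be shortened for ever. *)
Lemma maximal_lying_over_total x : B x \/ B x^-1.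
Proof.
have [->|x0] := eqVneq x 0; first by left.
apply: contrapT => nB.
have [g Jg gx] : exists2 g : {poly E}, (forall k, pos_ideal g`_k) & g.[x] = 1.
  by apply: ex_unit_relation => Bx; apply: nB; left.
have [h Jh hx] :
    exists2 g : {poly E}, (forall k, pos_ideal g`_k) & g.[x^-1] = 1.
  by apply: ex_unit_relation => Bx; apply: nB; right.
have [n] := ubnP (size g + size h).
elim: n x x0 g h Jg gx Jh hx {nB} => // n IHn x x0 g h Jg gx Jh hx lt_n.
have [le_hg|/ltnW le_gh] := leqP (size h) (size g).
  have [g' [Jg' gx' lt_g]] := shorten_unit_relation x0 Jg gx Jh hx le_hg.
  by apply: (IHn x x0 g' h) => //; lia.
have x0' : x^-1 != 0 by rewrite invr_eq0.
have gx' : g.[x^-1^-1] = 1 by rewrite invrK.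
have [h' [Jh' hx' lt_h]] := shorten_unit_relation x0' Jh hx Jg gx' le_gh.
by apply: (IHn x x0 g h') => //; lia.
Qed.

End MaximalRing.

(** Chevalley's extension theorem: for a maximal ring B lying over the base
ring, divisibility in B is the extended order. *)
Lemma extend_value_order : exists2 leE : rel E,
  value_order leE & forall x y, leE (f x) (f y) = le x y.
Proof.
have [B LB maxB] := ex_maximal_lying_over.
have tot := maximal_lying_over_total LB maxB.
have [[B1 BB BM] baseB B_le] := LB.
have [subB _ _] := LB.
have B0 : B 0 by apply: subring0.
pose leE x y := `[< exists2 c, B c & y = c * x >].
exists leE; first split.
- move=> x y; have [->|x0] := eqVneq x 0.
    by apply/orP; right; apply/asboolP; exists 0 => //; rewrite mul0r.
  have [->|y0] := eqVneq y 0.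
    by apply/orP; left; apply/asboolP; exists 0 => //; rewrite mul0r.
  have [h|h] := tot (y / x); apply/orP; [left|right]; apply/asboolP.
    by exists (y / x) => //; rewrite divfK.
  by exists (y / x)^-1 => //; rewrite invf_div divfK.
- move=> y x z /asboolP [c Bc ->] /asboolP [c' Bc' ->]; apply/asboolP.
  by exists (c' * c); [apply: BM|rewrite mulrA].
- move=> z x y z0; apply/asboolP/asboolP => -[c Bc e]; exists c => //.
    by apply: (mulfI z0); rewrite e; ring.
  by rewrite e; ring.
- move=> x y z /asboolP [c Bc ->] /asboolP [c' Bc' ->]; apply/asboolP.
  by exists (c + c'); [apply: subringD|rewrite mulrDl].
- by move=> x /asboolP [c _ ->]; rewrite mulr0.
move=> x y; have [->|x0] := eqVneq x 0.
  apply/asboolP/idP => [[c _]|/(vo_le0 vo) ->].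
    by rewrite rmorph0 mulr0 => /eqP; rewrite -[_ == 0]negbK f_neq0 negbK =>
      /eqP ->; apply: vle0.
  by exists 1 => //; rewrite mul1r.
apply/asboolP/idP => [[c Bc e]|xy].
  by apply: B_le => //; rewrite e mulfK // f_neq0.
exists (f y / f x); first by apply: baseB; exists y, x.
by rewrite divfK // f_neq0.
Qed.

End Chevalley.

(** * The order induced by a valuation *)

Section ValuationOrder.
Variables (F : fieldType) (G : oagType) (u : F -> withtop G).
Hypothesis hu : valuation u.

Lemma valuation0 : u 0 = PInf.
Proof. by have [h _ _] := hu; apply/h. Qed.

Lemma valuation_fin x : x != 0 -> exists g, u x = Fin g.
Proof.
have [h _ _] := hu; case E: (u x) => [g|]; first by exists g.
by move/h: E => ->; rewrite eqxx.
Qed.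

Lemma valuationM x y g g' : u x = Fin g -> u y = Fin g' ->
  u (x * y) = Fin (g + g').
Proof. by have [_ h _] := hu; rewrite h => -> ->. Qed.

Lemma valuation1 : u 1 = Fin 0.
Proof.
have [g e] := valuation_fin (oner_neq0 F); have := valuationM e e.
by rewrite mulr1 e => -[/esym/eqP];
  rewrite -[X in _ == X]addr0 (inj_eq (addrI g)) => /eqP ->.
Qed.

Lemma valuationX x g n : u x = Fin g -> u (x ^+ n) = Fin (g *+ n).
Proof.
move=> e; elim: n => [|n IHn]; first by rewrite expr0 mulr0n valuation1.
by rewrite exprS mulrS; apply: valuationM.
Qed.

Lemma valuation_order : value_order (fun x y => u x <= u y).
Proof.
have [u0 uM uD] := hu; split.
- by move=> x y; apply: le_total.
- by move=> y x z; apply: le_trans.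
- move=> z x y /valuation_fin [g e]; rewrite !uM e.
  case: (u x) (u y) => [a|] [b|] //=.
  have E (p q : G) : ((Fin p : withtop G) <= Fin q) = (p <= q) by [].
  rewrite !E; apply/idP/idP => h; last exact: oag_leDl.
  by rewrite -(addKr g a) -(addKr g b); apply: oag_leDl.
- move=> x y z xy xz; apply: le_trans (uD y z).
  by rewrite le_min xy.
- move=> x; rewrite valuation0 => h; apply/u0; apply/eqP.
  by case: (u x) h.
Qed.

End ValuationOrder.

Lemma value_order_comp (R S : idomainType) (f : {rmorphism R -> S}) (le :
  rel S) :
  injective f -> value_order le -> value_order (fun x y => le (f x) (f y)).
Proof.
move=> f_inj vo; split.
- by move=> x y; apply: (vo_total vo).
- by move=> y x z; apply: (vo_trans vo).
- by move=> z x y z0; rewrite !rmorphM vo_mul // -(rmorph0 f) (inj_eq f_inj).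
- by move=> x y z; rewrite rmorphD; apply: (vo_add vo).
- by move=> x; rewrite rmorph0 => /(vo_le0 vo) h; apply: f_inj;
  rewrite h rmorph0.
Qed.

(** * Values of algebraic elements *)

Section AlgebraicValues.
Variables (K L : fieldType) (i : {rmorphism K -> L}) (le : rel L).
Hypothesis vo : value_order le.

(** In an algebraic equation of x the smallest value is attained by two
different terms, since the sum is 0; comparing them gives the value of a power
of x. *)
Lemma algebraic_value x : algebraicOver i x -> x != 0 ->
  exists n a, [/\ (0 < n)%N, a != 0, le (x ^+ n) (i a) & le (i a) (x ^+ n)].
Proof.
move=> [p p0 px] x0; pose t j := i p`_j * x ^+ j.
pose s := [seq j <- iota 0 (size p) | p`_j != 0].
have t0 j : p`_j != 0 -> t j != 0.
  by move=> pj; rewrite mulf_neq0 ?expf_neq0 ?fmorph_eq0.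
have sE j : (j \in s) = (p`_j != 0).
  rewrite mem_filter mem_iota /= add0n; have [pj|//] := boolP (p`_j != 0).
  by rewrite ltnNge; apply: contra pj => h; rewrite nth_default.
have s0 : s != [::].
  apply: contraNneq p0 => s0; rewrite -lead_coef_eq0; apply: contraT => h.
  by have := sE (size p).-1; rewrite s0 h.
have [j js jmin] := @ex_extremum _ (fun a b => le (t a) (t b)) s
  (fun a b => vo_total vo _ _) (fun b a c => @vo_trans _ _ vo _ _ _) s0.
have [k [kj pk le_kj]] : exists k, [/\ k != j, p`_k != 0 & le (t k) (t j)].
  apply: contrapT => h.
  move: px; rewrite /root horner_coef size_map_poly.
  have pj : p`_j != 0 by rewrite -sE.
  have jsz : (j < size p)%N by rewrite ltnNge; apply: contra pj => h';
    rewrite nth_default.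
  rewrite (bigD1 (Ordinal jsz)) //=; set r := \sum_(_ | _) _.
  rewrite coef_map -/(t j) => /eqP e.
  have : ~~ le r (t j).
    rewrite /r; apply: (vlt_sum vo) => [|k]; first exact: t0.
    rewrite -val_eqE /= coef_map => kj.
    rewrite -/(t k); apply/negP => le_kj.
    have [pk|/negPn/eqP pk] := boolP (p`_k != 0); first by apply: h; exists (k :
      nat).
    by move: le_kj; rewrite /t pk rmorph0 mul0r (negbTE (vlt0 vo (t0 j pj))).
  by move/(vlt_addl vo); rewrite e (negbTE (vlt0 vo (t0 j pj))).
have le_jk : le (t j) (t k) by apply: jmin; rewrite sE.
have pj : p`_j != 0 by rewrite -sE.
have main a b : (a < b)%N -> p`_a != 0 -> p`_b != 0 -> le (t a) (t b) ->
  le (t b) (t a) ->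
    exists n c, [/\ (0 < n)%N, c != 0, le (x ^+ n) (i c) & le (i c) (x ^+ n)].
  move=> ab pa pb h1 h2; exists (b - a)%N, (p`_a / p`_b).
  have e : t a = i p`_b * x ^+ a * i (p`_a / p`_b).
    by rewrite /t fmorph_div; field; rewrite fmorph_eq0.
  have e' : t b = i p`_b * x ^+ a * x ^+ (b - a).
    by rewrite -mulrA -exprD subnKC // ltnW.
  have nz : i p`_b * x ^+ a != 0 by rewrite mulf_neq0 ?expf_neq0 ?fmorph_eq0.
  rewrite subn_gt0 ab mulf_neq0 ?invr_eq0 //; split=> //.
    by rewrite -(vo_mul vo _ _ nz) -e -e'.
  by rewrite -(vo_mul vo _ _ nz) -e -e'.
move: kj; rewrite neq_ltn => /orP[] lt.
  exact: (main k j lt pk pj le_kj le_jk).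
exact: (main j k lt pj pk le_jk le_kj).
Qed.

End AlgebraicValues.

Section RadicalValues.
Variables (K : fieldType) (L : closedFieldType) (i : {rmorphism K -> L}).
Hypothesis halg : forall x : L, algebraicOver i x.

Definition radical (y : L) := exists n a, (0 < n)%N /\ y ^+ n = i a.

Lemma radicalM y y' : radical y -> radical y' -> radical (y * y').
Proof.
move=> [n [a [n0 e]]] [m [b [m0 e']]]; exists (n * m)%N, (a ^+ m * b ^+ n).
rewrite muln_gt0 n0 m0 rmorphM !rmorphXn exprMn exprM e.
rewrite [in y' ^+ _]mulnC exprM e'.
by [].
Qed.

(** Radicals over K represent all the values of L, and their values are
determined by the values on K: this compares two extensions of the same
valuation without constructing a common value group. *)
Lemma radical_value le x : value_order le ->
  exists y, [/\ radical y, le x y & le y x].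
Proof.
move=> vo; have [->|x0] := eqVneq x 0.
  by exists 0; split; rewrite ?(vle_refl vo) //; exists 1%N, 0;
    rewrite expr1 rmorph0.
have [n [a [n0 a0 h1 h2]]] := algebraic_value vo (halg x) x0.
have [y] : exists y, root ('X^n - (i a)%:P) y.
  by apply/closed_rootP; rewrite size_XnsubC // eqSS -lt0n.
rewrite rootE !hornerE subr_eq0 => /eqP e.
exists y; split; first by exists n, a.
  by rewrite -(vle_exp2 vo _ _ n0) e.
by rewrite -(vle_exp2 vo _ _ n0) e.
Qed.

Lemma radical_le le1 le2 y y' : value_order le1 -> value_order le2 ->
    (forall a b, le1 (i a) (i b) = le2 (i a) (i b)) ->
  radical y -> radical y' -> le1 y y' = le2 y y'.
Proof.
move=> vo1 vo2 agree [n [a [n0 e]]] [m [b [m0 e']]].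
have nm0 : (0 < n * m)%N by rewrite muln_gt0 n0.
rewrite -(vle_exp2 vo1 _ _ nm0) -(vle_exp2 vo2 _ _ nm0).
by rewrite exprM e mulnC exprM e' -!rmorphXn.
Qed.

End RadicalValues.

(** * Uniqueness of extensions over a henselian field *)

Section Henselian.
Variables (K : fieldType) (G : oagType) (v : K -> withtop G).
Hypothesis hens : henselian v.
Variables (L : closedFieldType) (i : {rmorphism K -> L}).
Hypothesis halg : forall x : L, algebraicOver i x.
Variables (Gb : oagType) (vb : L -> withtop Gb).
Hypotheses (hvb : valuation vb) (hext : extends i v vb).

(** The henselian property compares valuations only. To apply it, le has to be
turned into a valuation u with values in a group containing that of v. The
group of vb will do: u x is the value under vb of a radical y that has the same
value as x for le. *)
Lemma henselian_order le : value_order le ->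
    (forall a b, le (i a) (i b) = (v a <= v b)) ->
  forall x y, le x y = (vb x <= vb y).
Proof.
move=> vo le_v; have vob := valuation_order hvb.
have [j [jmono jv]] := hext.
have vb_v a b : (vb (i a) <= vb (i b)) = (v a <= v b).
  rewrite !jv; case: (v a) (v b) => [g|] [g'|] //=; exact: jmono.
have agree a b : le (i a) (i b) = (vb (i a) <= vb (i b)) by rewrite le_v vb_v.
(* rho x is a radical over K with the same value as x. *)
have /choice [rho rhoP] := fun x => radical_value halg x vo.
have rad_eq x y : radical i x -> radical i y -> le x y -> le y x -> vb x = vb y.
  move=> rx ry; rewrite !(radical_le vo vob agree) // => h1 h2.
  by apply/eqP; rewrite eq_le h1.
have rad_le x y : le x y = (vb (rho x) <= vb (rho y)).
  have [rx h1 h2] := rhoP x; have [ry h3 h4] := rhoP y.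
  rewrite -(radical_le vo vob agree) //; apply/idP/idP => h.
    by apply: (vle_trans vo h2); apply: (vle_trans vo h).
  by apply: (vle_trans vo h1); apply: (vle_trans vo h).
have radi a : radical i (i a) by exists 1%N, a; rewrite expr1.
have hu : valuation (fun x => vb (rho x)).
  have [vb0 vbM vbD] := hvb; split.
  - move=> x; have [rx h1 h2] := rhoP x; rewrite vb0; split=> [e|->].
      by rewrite e in h2; apply: (vo_le0 vo).
    by have [_ h _] := rhoP 0; apply: (vo_le0 vo).
  - move=> x y; have [rx h1 h2] := rhoP x; have [ry h3 h4] := rhoP y.
    have [rxy h5 h6] := rhoP (x * y).
    rewrite -vbM; apply: rad_eq => //; first exact: radicalM.
      by apply: (vle_trans vo h6); apply: (vle_mul vo).
    by apply: (vle_trans vo _ h5); apply: (vle_mul vo).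
  - move=> x y; rewrite ge_min -!rad_le; have /orP[h|h] := vo_total vo x y.
      by rewrite (vo_add vo) ?(vle_refl vo).
    by rewrite [X in _ || X](vo_add vo) ?(vle_refl vo) // orbT.
have hu_ext : extends i v (fun x => vb (rho x)).
  exists j; split=> // a; rewrite -jv; have [ra h1 h2] := rhoP (i a).
  exact: rad_eq.
by move=> x y; rewrite rad_le; apply: (hens halg hu hvb hu_ext hext).
Qed.

Lemma irreducible_dvd (Q g : {poly K}) (t : L) :
  irreducible_poly Q -> root (map_poly i Q) t ->
  root (map_poly i g) t = (Q %| g)%R.
Proof.
move=> irrQ Qt; have := irreducible_poly_coprime g irrQ.
have [/dvdpP [h ->] _|_ /= cop] := boolP (Q %| g);
  first by rewrite rmorphM rootM Qt orbT.
apply/negbTE/coprimep_root => //; last exact: Qt.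
by rewrite coprimep_map cop.
Qed.

(** The two K-embeddings of K[X] / (Q) into L that send X to t and to t' pull
vb back to two valuations extending v. *)
Lemma conjugate_value (Q g h : {poly K}) (t t' : L) :
    irreducible_poly Q -> root (map_poly i Q) t -> root (map_poly i Q) t' ->
  (vb (map_poly i g).[t] <= vb (map_poly i h).[t]) =
  (vb (map_poly i g).[t'] <= vb (map_poly i h).[t']).
Proof.
move=> irrQ Qt Qt'; have Q0 := irredp_neq0 irrQ.
pose S := subFExtend i t Q; pose ev : {rmorphism {poly K} -> S} :=
  subfx_eval i t Q.
have ev_inj p : subfx_inj (ev p) = (map_poly i p).[t] := subfx_inj_eval Qt Q0 p.
have ev0 s p : root (map_poly i Q) s -> ((map_poly i p).[s] = 0) <-> (ev p = 0).
  move=> Qs; have : ((map_poly i p).[s] == 0) = (ev p == 0).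
    rewrite -rootE (irreducible_dvd _ irrQ Qs) -(irreducible_dvd _ irrQ Qt).
    by rewrite rootE -ev_inj fmorph_eq0.
  by move=> e; split=> /eqP s0; apply/eqP; rewrite ?e // -e.
have /choice [rep repP] := fun x : S => subfxE x.
pose phi s (x : S) := (map_poly i (rep x)).[s].
have phiE s p : root (map_poly i Q) s -> phi s (ev p) = (map_poly i p).[s].
  move=> Qs; apply/eqP; rewrite -subr_eq0 -hornerN -hornerD -rmorphB;
    apply/eqP/(ev0 _ _ Qs).
  by rewrite rmorphB -[ev (rep _)]repP subrr.
have hphi s : root (map_poly i Q) s -> valuation (fun x => vb (phi s x)).
  move=> Qs; have [vb0 vbM vbD] := hvb; split.
  - by move=> x; rewrite vb0 /phi ev0 // -[ev _]repP.
  - move=> x y; rewrite -vbM; congr (vb _).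
    by rewrite {1}(repP x) {1}(repP y) -rmorphM phiE // rmorphM hornerM.
  - move=> x y; have -> : phi s (x + y) = phi s x + phi s y; last exact: vbD.
    by rewrite {1}(repP x) {1}(repP y) -rmorphD phiE // rmorphD hornerD.
have phi_ext s : root (map_poly i Q) s ->
    extends (inj_subfx i t Q) v (fun x => vb (phi s x)).
  move=> Qs; have [j [jmono jv]] := hext; exists j; split=> // a.
  by rewrite -jv (phiE s a%:P Qs) map_polyC hornerC.
have alg x : algebraicOver (inj_subfx i t Q) x.
  have [p p0 px] := halg (subfx_inj x); exists p => //.
  rewrite -(fmorph_root (subfx_inj (z := t) (p := Q) (iota := i))).
  rewrite -map_poly_comp (eq_map_poly (g := i)) // => a /=.
  by rewrite -[RHS](hornerC _ t) -map_polyC -ev_inj.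
have := hens alg (hphi t Qt) (hphi t' Qt')
  (phi_ext t Qt) (phi_ext t' Qt') (ev g) (ev h).
by rewrite !phiE.
Qed.

End Henselian.

(** * Degrees of algebraic elements *)

Section Degree.
Variables (K : fieldType) (L : closedFieldType) (i : {rmorphism K -> L}).

(** Expressing each basis in the other gives matrices whose product is the
identity. *)
Lemma basis_size_le (V : set L) n m (b : 'I_n -> L) (b' : 'I_m -> L) :
  is_basis i V b -> is_basis i V b' -> (n <= m)%N.
Proof.
move=> [Vb bE] [Vb' bE'].
have /choice [A HA] k := bE' _ (Vb k); have /choice [A' HA'] k := bE _ (Vb' k).
pose M := \matrix_(k, l) A k 0 l; pose M' := \matrix_(k, l) A' k 0 l.
apply: (@mulmx1_min _ _ _ M M'); apply/row_matrixP => k.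
have [c [cE c_uniq]] := bE _ (Vb k).
transitivity c; last apply: c_uniq.
  have eA' l : b' l = \sum_k i (A' l 0 k) * b k by have [] := HA' l.
  apply/esym/c_uniq; have [-> _] := HA k.
  under [LHS]eq_bigr => l _ do rewrite eA' mulr_sumr.
  rewrite exchange_big; apply: eq_bigr => j _ /=.
  rewrite !mxE rmorph_sum mulr_suml.
  by apply: eq_bigr => l _; rewrite !mxE rmorphM mulrA.
rewrite (bigD1 k) //= big1 ?addr0 => [|l lk]; rewrite !mxE.
  by rewrite eqxx rmorph1 mul1r.
by rewrite eq_sym (negbTE lk) rmorph0 mul0r.
Qed.

Lemma degree_irreducible (Q : {poly K}) (t : L) :
  irreducible_poly Q -> root (map_poly i Q) t -> degree i t = pdeg Q.
Proof.
move=> irrQ Qt; have Q0 := irredp_neq0 irrQ.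
have sQ : size Q = (pdeg Q).+1 by rewrite /pdeg prednK // size_poly_gt0.
have comb (c : 'rV[K]_(pdeg Q)) :
    \sum_k i (c 0 k) * t ^+ k = (map_poly i (rVpoly c)).[t].
  rewrite (@horner_coef_wide _ (pdeg Q));
    last by rewrite size_map_poly size_poly.
  by apply: eq_bigr => k _; rewrite coef_map coef_rVpoly_ord.
have bas : is_basis i (adjoin i t) (fun k : 'I_(pdeg Q) => t ^+ k).
  split=> [k|_ [p [q [qt ->]]]].
    exists 'X^k, 1; rewrite rmorph1 map_polyXn hornerXn hornerC oner_neq0 divr1.
    by split.
  have cop : coprimep Q q.
    by rewrite irreducible_poly_coprime // -(irreducible_dvd _ irrQ Qt).
  have [[a b] /= ab] := Bezout_eq1_coprimepP _ _ cop.
  have bt : (map_poly i b).[t] * (map_poly i q).[t] = 1.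
    have := congr1 (fun p => (map_poly i p).[t]) ab.
    by rewrite /= rmorphD !rmorphM rmorph1 !hornerE (rootP Qt) mulr0 add0r.
  have -> : (map_poly i p).[t] / (map_poly i q).[t] =
      (map_poly i ((p * b) %% Q)).[t].
    apply: (mulIf qt); rewrite divfK //.
    have e := congr1 (fun p => (map_poly i p).[t]) (divp_eq (p * b) Q).
    rewrite /= rmorphD !rmorphM !hornerE (rootP Qt) mulr0 add0r in e.
    by rewrite -e -mulrA bt mulr1.
  have sr : (size ((p * b) %% Q)%R <= pdeg Q)%N by rewrite -ltnS -sQ ltn_modp.
  exists (poly_rV ((p * b) %% Q)); split; first by rewrite comb poly_rV_K.
  move=> c' e; apply: (can_inj rVpolyK); apply/eqP; rewrite -subr_eq0.
  have : (Q %| rVpoly (poly_rV (d := pdeg Q) ((p * b) %% Q)) - rVpoly c')%R.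
    rewrite -(irreducible_dvd _ irrQ Qt) rootE rmorphB !hornerE poly_rV_K //.
    by rewrite e comb subrr.
  apply: contraLR => nz; apply: contraTN isT => /(dvdp_leq nz);
    rewrite sQ ltnNge.
  by rewrite (leq_trans (size_polyD _ _)) // size_polyN geq_max !size_poly.
apply: xget_unique; first by exists (fun k => t ^+ k).
move=> m [b' bas']; apply/eqP; rewrite eqn_leq.
by rewrite (basis_size_le bas' bas) (basis_size_le bas bas').
Qed.

Lemma ex_irreducible_root (t : L) : algebraicOver i t ->
  exists Q : {poly K}, [/\ irreducible_poly Q & root (map_poly i Q) t].
Proof.
move=> [p0 p00 p0t]; have [n] := ubnP (size p0); elim: n p0 p00 p0t =>
  // n IHn p pn0 pt lt_n.
have sp : (1 < size p)%N by rewrite -(size_map_poly i); apply: root_size_gt1 pt;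
  rewrite map_poly_eq0.
have [irr|nirr] := pselect (irreducible_poly p); first by exists p.
have [q [sq qp nqp]] : exists q : {poly K}, [/\ size q != 1%N,
  (q %| p)%R & ~~ (q %= p)%R].
  apply: contrapT => h; apply: nirr; split=> // q sq qp; apply: contrapT =>
    /negP nqp.
  by apply: h; exists q.
have /dvdpP [r pE] := qp.
have q0 : q != 0 by apply: contraNneq pn0 => q0; rewrite pE q0 mulr0.
have r0 : r != 0 by apply: contraNneq pn0 => r0; rewrite pE r0 mul0r.
have sqlt : (size q < size p)%N.
  rewrite ltn_neqAle dvdp_leq // andbT; apply: contra nqp => s.
  by rewrite -dvdp_size_eqp.
have srlt : (size r < size p)%N.
  rewrite pE size_mul //; move: sq q0; rewrite -size_poly_gt0; case: (size q) =>
    [|[|s]] //= _ _.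
  by rewrite !addnS /= ltnS leq_addr.
move: pt; rewrite pE rmorphM rootM => /orP[rt|qt].
  by apply: (IHn r) => //; apply: leq_trans srlt _; rewrite -ltnS.
by apply: (IHn q) => //; apply: leq_trans sqlt _; rewrite -ltnS.
Qed.

End Degree.

(** * Key polynomials and the roots nearest to X *)

Lemma oag_le_sub (H : oagType) (x y z t : H) :
  (x - y <= z - t) = (x + t <= y + z).
Proof.
have mono (p q r : H) : (r + p <= r + q) = (p <= q).
  apply/idP/idP => h; last exact: oag_leDl.
  by rewrite -(addKr r p) -(addKr r q); apply: oag_leDl.
rewrite -(mono _ _ (y + t)) (addrC x) addrA (addrC y) addrK addrC.
by rewrite (addrC z) addrA (addrC t) addrK.
Qed.

(** The field E plays the role of L(X); emb f is then f as an element of E, and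
X - kappa b is the polynomial X - b. *)
Section CommonExtension.
Variables (K : fieldType) (L : closedFieldType) (E : fieldType).
Variables (i : {rmorphism K -> L}) (kappa : {rmorphism L -> E}) (X : E).
Hypothesis X_transc : forall b, X != kappa b.
Variable le : rel E.
Hypothesis vo : value_order le.
Implicit Types f g Q : {poly K}.

Definition poly_over f : {poly E} := map_poly kappa (map_poly i f).
Definition emb f : E := (poly_over f).[X].
Definition roots_of f : seq L := sval (closed_field_poly_normal (map_poly i f)).
Definition lc f : E := kappa (i (lead_coef f)).

Lemma embM : {morph emb : f g / f * g}.
Proof. by move=> f g; rewrite /emb /poly_over !rmorphM hornerM. Qed.

Lemma emb0 : emb 0 = 0.
Proof. by rewrite /emb /poly_over !rmorph0 horner0. Qed.

Lemma embX f n : emb (f ^+ n) = emb f ^+ n.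
Proof. by rewrite /emb /poly_over !rmorphXn horner_exp. Qed.

Lemma poly_over_nderivn f b : (poly_over f)^`N(b).[X] = emb f^`N(b).
Proof. by rewrite /emb /poly_over !nderivn_map. Qed.

Lemma poly_over_split f :
  poly_over f = lc f *: \prod_(a <- map kappa (roots_of f)) ('X - a%:P).
Proof.
rewrite /poly_over /roots_of; case: closed_field_poly_normal => s /= {1}->.
rewrite map_polyZ lead_coef_map; congr (_ *: _).
rewrite rmorph_prod big_map; apply: eq_bigr => a _ /=.
by rewrite rmorphB /= map_polyX map_polyC.
Qed.

Lemma emb_split f : emb f = lc f * \prod_(b <- roots_of f) (X - kappa b).
Proof.
rewrite /emb poly_over_split hornerZ horner_prod big_map; congr (_ * _).
by apply: eq_bigr => b _; rewrite !hornerE.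
Qed.

Lemma lc_neq0 f : (lc f != 0) = (f != 0).
Proof. by rewrite /lc !fmorph_eq0 lead_coef_eq0. Qed.

Lemma X_sub_neq0 b : X - kappa b != 0.
Proof. by rewrite subr_eq0 X_transc. Qed.

Lemma emb_neq0 f : (emb f != 0) = (f != 0).
Proof.
apply/idP/idP => [|f0]; first by apply: contraNneq => ->; rewrite emb0.
rewrite emb_split mulf_neq0 ?lc_neq0 // prodf_seq_neq0.
by apply/allP => b _; apply: X_sub_neq0.
Qed.

Lemma mem_roots_of f b : f != 0 -> (b \in roots_of f) = root (map_poly i f) b.
Proof.
move=> f0; rewrite /roots_of; case: closed_field_poly_normal => s /= ->.
rewrite rootZ ?root_prod_XsubC // lead_coef_eq0.
by rewrite map_poly_eq0.
Qed.

Definition nearest_root f a : Prop :=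
  root (map_poly i f) a /\
  forall b, root (map_poly i f) b -> le (X - kappa b) (X - kappa a).

Lemma pdeg_gt0_neq0 f : (0 < pdeg f)%N -> f != 0.
Proof. by apply: contraTneq => ->; rewrite /pdeg size_poly0. Qed.

Lemma ex_nearest_root f : (0 < pdeg f)%N -> exists a, nearest_root f a.
Proof.
move=> df; have f0 := pdeg_gt0_neq0 df.
have [a ra] : exists a, root (map_poly i f) a.
  apply/closed_rootP; rewrite size_map_poly; move: df.
  by rewrite /pdeg; case: (size f) => [|[]].
have r0 : roots_of f != [::].
  by apply: contraTneq ra => r0; rewrite -mem_roots_of // r0.
have [c cr cmax] := @ex_extremum _ (fun a b => le (X - kappa b) (X - kappa a)) _
  (fun a b => vo_total vo _ _) (fun b a c h1 h2 => vle_trans vo h2 h1) r0.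
exists c; split=> [|b]; first by rewrite -mem_roots_of.
by rewrite -mem_roots_of // => /cmax.
Qed.

Lemma nearest_root_slope f a : (0 < pdeg f)%N -> nearest_root f a ->
  (forall b, le (emb f) (emb f^`N(b) * (X - kappa a) ^+ b)) /\
  exists2 N, (0 < N)%N & le (emb f^`N(N) * (X - kappa a) ^+ N) (emb f).
Proof.
move=> df [ra amax]; have f0 := pdeg_gt0_neq0 df.
have k0 : lc f != 0 by rewrite lc_neq0.
have am : kappa a \in map kappa (roots_of f) by rewrite map_f // mem_roots_of.
have mx : forall c, c \in map kappa (roots_of f) -> le (X - c) (X - kappa a).
  by move=> _ /mapP [b br ->]; apply: amax; rewrite -mem_roots_of.
have [h1 [N N0 h2]] :=
  nearest_root_deriv vo k0 (X_sub_neq0 a) (poly_over_split f) am mx.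
split; first by move=> b; rewrite -poly_over_nderivn.
by exists N; rewrite // -poly_over_nderivn.
Qed.

Variables (H : oagType) (w : {fraction {poly K}} -> withtop H).
Hypothesis hw : valuation w.
Hypothesis le_w : forall f g, le (emb f) (emb g) = (w f%:F <= w g%:F).

Lemma w_fin f : f != 0 -> exists x, w f%:F = Fin x.
Proof. by move=> f0; apply: valuation_fin => //; rewrite tofrac_eq0. Qed.

(** Comparing the slopes (w f - w p) / b and (w f' - w p') / c amounts, after
clearing denominators, to comparing the values of two elements of K[X]. *)
Lemma slope_le f p f' p' x y x' y' b c : (0 < b)%N -> (0 < c)%N ->
    w f%:F = Fin x -> w p%:F = Fin y -> w f'%:F = Fin x' -> w p'%:F = Fin y' ->
  (divhull_div (x - y) b <= divhull_div (x' - y') c) =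
  le (emb f ^+ c * emb p' ^+ b) (emb p ^+ c * emb f' ^+ b).
Proof.
move=> b0 c0 wf wp wf' wp'; rewrite divhull_div_le // -!embX -!embM le_w.
rewrite !tofracM !tofracXn (valuationM hw (valuationX hw c wf)
  (valuationX hw b wp')).
rewrite (valuationM hw (valuationX hw c wp) (valuationX hw b wf')).
by rewrite -[RHS]oag_le_sub -!mulrnBl.
Qed.

(** The N found on the Newton polygon attains the maximum in eps f; with p the
N-th derivative, the slope is the value of X - a. *)
Lemma eps_nearest f a : (0 < pdeg f)%N -> nearest_root f a ->
  exists N p x y, [/\ (0 < N)%N, w f%:F = Fin x, w p%:F = Fin y,
    eps w f = FinB (divhull_div (x - y) N)
    & le (emb p * (X - kappa a) ^+ N) (emb f) /\
      le (emb f) (emb p * (X - kappa a) ^+ N)].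
Proof.
move=> df ra; have f0 := pdeg_gt0_neq0 df.
have [hle [N N0 hge]] := nearest_root_slope df ra.
have p0 : f^`N(N) != 0.
  by apply: contraTneq hge => ->; rewrite emb0 mul0r vlt0 // emb_neq0.
have ltN : (N < size f)%N.
  by rewrite ltnNge; apply: contra p0 => h; rewrite nderivn_poly0.
have [x wx] := w_fin f0; have [y wy] := w_fin p0.
exists N, f^`N(N), x, y; split=> //; apply/le_anti/andP; split; last first.
  have -> : FinB (divhull_div (x - y) N) = eps_slope w f N.
    by rewrite /eps_slope wx wy.
  by apply: le_bigmax_seq; rewrite // mem_index_iota N0.
rewrite /eps big_seq_cond; apply: bigmax_le => // b;
  rewrite mem_index_iota andbT.
move=> /andP[b0 ltb]; have [pb0|pb0] := eqVneq f^`N(b) 0.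
  by rewrite /eps_slope pb0 wx rmorph0 valuation0.
have [z wz] := w_fin pb0; rewrite /eps_slope wx wz.
change (divhull_div (x - z) b <= divhull_div (x - y) N).
rewrite (slope_le b0 N0 wx wz wx wy).
set d := X - kappa a.
have d0 : d ^+ (N * b) != 0 by rewrite expf_neq0 ?X_sub_neq0.
rewrite -(vo_mul vo _ _ d0) mulrC -mulrA [X in le _ X](_ : _ =
  (emb f^`N(b) * d ^+ b) ^+ N * emb f ^+ b); last first.
  by rewrite exprMn -exprM (mulnC N); ring.
apply: (vle_mul vo); first exact: vle_exp.
by rewrite exprM -exprMn; apply: vle_exp.
Qed.

(** With eps Q = (w Q - w p) / N and eps f = (w f - w q) / M, the inequality
becomes one between products; replacing Q by p d^N and f by q d'^M, which have
the same values, leaves d^(N M) and d'^(N M) after cancellation. *)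
Lemma eps_le Q f a c : (0 < pdeg Q)%N -> (0 < pdeg f)%N ->
    nearest_root Q a -> nearest_root f c ->
  (eps w Q <= eps w f) = le (X - kappa a) (X - kappa c).
Proof.
move=> dQ df ra rc.
have [N [p [x [y [N0 wx wy -> [h1 h2]]]]]] := eps_nearest dQ ra.
have [M [q [x' [y' [M0 wx' wy' -> [h3 h4]]]]]] := eps_nearest df rc.
change (divhull_div (x - y) N <= divhull_div (x' - y') M =
  le (X - kappa a) (X - kappa c)).
rewrite (slope_le N0 M0 wx wy wx' wy').
set d := X - kappa a; set d' := X - kappa c.
have nz g z : w g%:F = Fin z -> emb g != 0.
  move=> wg; rewrite emb_neq0; apply/eqP => g0.
  by move: wg; rewrite g0 rmorph0 valuation0.
have NM0 : (0 < N * M)%N by rewrite muln_gt0 N0.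
have P0 : emb p ^+ M * emb q ^+ N != 0.
  by rewrite mulf_neq0 // expf_neq0 // (nz _ _ wy, nz _ _ wy').
rewrite -(vle_exp2 vo d d' NM0) -(vo_mul vo (d ^+ _) (d' ^+ _) P0).
have -> : emb p ^+ M * emb q ^+ N * d ^+ (N * M) =
    (emb p * d ^+ N) ^+ M * emb q ^+ N.
  by rewrite exprMn -exprM; ring.
have -> : emb p ^+ M * emb q ^+ N * d' ^+ (N * M) =
    emb p ^+ M * (emb q * d' ^+ M) ^+ N.
  by rewrite exprMn -exprM (mulnC M); ring.
have r (z : E) : le z z := vle_refl vo z.
apply/idP/idP => h.
  apply: (vle_trans vo (y := emb Q ^+ M * emb q ^+ N));
    first by apply: (vle_mul vo); rewrite ?(vle_exp vo).
  by apply: (vle_trans vo h); apply: (vle_mul vo); rewrite ?(vle_exp vo).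
apply: (vle_trans vo (y := (emb p * d ^+ N) ^+ M * emb q ^+ N)).
  by apply: (vle_mul vo); rewrite ?(vle_exp vo).
by apply: (vle_trans vo h); apply: (vle_mul vo); rewrite ?(vle_exp vo).
Qed.

(** A root of f as near to X as the nearest root of Q would give f a larger eps
than Q, hence a degree at least that of Q. *)
Lemma abkp_far_roots Q a f b : abkp w Q -> nearest_root Q a ->
  f != 0 -> (pdeg f < pdeg Q)%N -> root (map_poly i f) b ->
  ~~ le (X - kappa a) (X - kappa b).
Proof.
move=> [_ dQ Qmin] ra f0 lt_f rb; apply: contraL lt_f => h.
rewrite -leqNgt; apply: Qmin.
have df : (0 < pdeg f)%N.
  rewrite /pdeg -ltnS prednK ?size_poly_gt0 // -(size_map_poly i).
  by apply: root_size_gt1 rb; rewrite map_poly_eq0.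
have [c rc] := ex_nearest_root df; rewrite (eps_le dQ df ra rc).
by apply: (vle_trans vo h); have [_ cmax] := rc; apply: cmax.
Qed.

(** In a nontrivial factorisation of Q the root nearest to X would belong to a
factor of smaller degree, all of whose roots are farther by abkp_far_roots. *)
Lemma abkp_irreducible Q : abkp w Q -> irreducible_poly Q.
Proof.
move=> hQ; have [_ dQ _] := hQ; have Q0 := pdeg_gt0_neq0 dQ.
split=> [|q sq /dvdpP [r QE]]; first by move: dQ; rewrite /pdeg;
  case: (size Q) => [|[]].
have q0 : q != 0 by apply: contraNneq Q0 => q0; rewrite QE q0 mulr0.
have r0 : r != 0 by apply: contraNneq Q0 => r0; rewrite QE r0 mul0r.
have sQ : pdeg Q = (pdeg r + pdeg q)%N.
  rewrite /pdeg QE size_mul //; move: q0 r0; rewrite -!size_poly_gt0.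
  by case: (size q) => // m; case: (size r) => // n _ _; rewrite addnS.
have dq : (0 < pdeg q)%N.
  by move: sq q0; rewrite /pdeg -size_poly_gt0; case: (size q) => [|[]].
have dvd : (q %| Q)%R by rewrite QE dvdp_mulIr.
have [dr|dr] := posnP (pdeg r).
  rewrite -(dvdp_size_eqp dvd) -(prednK (n := size q)) ?size_poly_gt0 //.
  by rewrite -(prednK (n := size Q)) ?size_poly_gt0 // -!/(pdeg _) sQ dr.
have [a ra] := ex_nearest_root dQ; have [Qa _] := ra; exfalso.
move: Qa; rewrite QE rmorphM rootM => /orP[h|h].
  have := abkp_far_roots hQ ra r0 _ h; rewrite (vle_refl vo) => X0.
  by have : false by apply: X0; rewrite sQ -[X in (X < _)%N]addn0 ltn_add2l.
have := abkp_far_roots hQ ra q0 _ h; rewrite (vle_refl vo) => X0.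
by have : false by apply: X0; rewrite sQ -[X in (X < _)%N]add0n ltn_add2r.
Qed.

Section Truncation.
Variables (Q : {poly K}) (a : L).
Hypotheses (hQ : abkp w Q) (ra : nearest_root Q a).

Let d := X - kappa a.
Let d0 : d != 0. Proof. exact: X_sub_neq0. Qed.
Let S f := rescale (poly_over f) (kappa a) d.
Let M f := lc f * \prod_(b <- roots_of f) vmin le d (kappa a - kappa b).
Let N f := count (fun b => le d (kappa a - kappa b)) (roots_of f).

Let SD f g : S (f + g) = S f + S g.
Proof. by rewrite /S /rescale /poly_over !rmorphD. Qed.
Let SM f g : S (f * g) = S f * S g.
Proof. by rewrite /S /rescale /poly_over !rmorphM. Qed.
Let SX f n : S (f ^+ n) = S f ^+ n.
Proof. by elim: n => [|n IHn];
  rewrite ?expr0 ?exprS ?SM ?IHn // /S /rescale /poly_over !rmorph1. Qed.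

Let SMN f : f != 0 -> dominant le (S f) (M f) (N f).
Proof.
move=> f0; have k0 : lc f != 0 by rewrite lc_neq0.
have := dominant_rescale vo (map kappa (roots_of f)) (kappa a) k0 d0.
by rewrite -poly_over_split big_map count_map.
Qed.

Let M_lt f : f != 0 ->
  ~~ le (emb f) (M f) = has (fun b => ~~ le (X - kappa b) d) (roots_of f).
Proof.
move=> f0; have k0 : lc f != 0 by rewrite lc_neq0.
have := vmin_prod_lt vo (map kappa (roots_of f)) k0 d0.
by rewrite emb_split !big_map has_map.
Qed.

Let M_le f : le (M f) (emb f).
Proof.
rewrite emb_split; apply: (vle_mul vo); first exact: vle_refl.
apply: (vle_prod vo) => b _.
have -> : kappa a - kappa b = (X - kappa b) - d by rewrite /d; ring.
by have [] := vmin_sub vo d (X - kappa b).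
Qed.

Let emb_le_M f : f != 0 ->
    (forall b, root (map_poly i f) b -> le (X - kappa b) d) ->
  le (emb f) (M f).
Proof.
move=> f0 h; apply/negPn; rewrite M_lt // -all_predC; apply/allP => b.
by rewrite mem_roots_of //= negbK => /h.
Qed.

(** Let M be the Gauss value of centre a and radius d, and N the number of
roots in the ball with the same centre and radius. M agrees with w on the
coefficients of the Q-expansion, whose roots are farther from X than a, and on
Q, whose roots are not nearer than a. The coefficients have no root in the
ball, while Q has N Q > 0 of them, so that the dominant exponents j * N Q of
the terms of the expansion differ. Hence no cancellation occurs in the sum, and
M f is the minimum of the values of the terms, that is w_Q f. Finally M f is
smaller than w f when a factor X - b of f is nearer than d. *)
Lemma truncation_lt f : f != 0 ->
  (truncation w Q f < w f%:F) =
  has (fun b => ~~ le (X - kappa b) d) (roots_of f).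
Proof.
have [Qmon dQ _] := hQ; have Q0 := pdeg_gt0_neq0 dQ.
move=> f0; have [szc fE] := Qexpansion Qmon dQ f.
have NQ : (0 < N Q)%N.
  rewrite -has_count; apply/hasP; exists a; rewrite ?mem_roots_of //;
    first by case: ra.
  by rewrite subrr vle0.
have termP j : Qcoef Q f j != 0 -> exists m,
    [/\ dominant le (S (Qcoef Q f j * Q ^+ j)) m (j * N Q),
        le m (emb (Qcoef Q f j * Q ^+ j)) & le (emb (Qcoef Q f j * Q ^+ j)) m].
  set c := Qcoef Q f j => c0.
  have far b : root (map_poly i c) b -> ~~ le d (X - kappa b).
    apply: (abkp_far_roots hQ ra c0); rewrite /pdeg.
    rewrite -size_poly_gt0 in c0; have := szc j; rewrite -/c; move: c0.
    by case: (size c) => // m _; case: (size Q).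
  have Nc : N c = 0%N.
    apply/eqP; rewrite -leqn0 leqNgt -has_count -all_predC; apply/allP => b.
    rewrite mem_roots_of //= => /far; apply: contra => h.
    have -> : X - kappa b = (kappa a - kappa b) + d by rewrite /d; ring.
    by apply: (vo_add vo) => //; apply: (vle_refl vo).
  exists (M c * M Q ^+ j); split.
  - rewrite SM SX -[(_ * _)%N]add0n -[in X in (X + _)%N]Nc.
    by apply: (dominant_mul vo); [apply: SMN|apply: (dominant_exp vo);
      apply: SMN].
  - by rewrite embM embX; apply: (vle_mul vo); rewrite ?(vle_exp vo) ?M_le.
  - rewrite embM embX; apply: (vle_mul vo); rewrite ?(vle_exp vo) ?emb_le_M //.
      by move=> b /far /(vltW vo).
    by move=> b; case: ra => _; apply.
pose g k := \sum_(j < k) Qcoef Q f j * Q ^+ j.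
(* The dominant exponent of the sum of the first k terms is below k * N Q, the
   dominant exponent of the next term, so that the two cannot cancel. *)
have partial k : (forall j, (j < k)%N -> Qcoef Q f j = 0) \/
    exists h m n, [/\ dominant le (S (g k)) m n, (n < k * N Q)%N,
      le m (emb h) /\ le (emb h) m,
      exists2 j, (j < k)%N & h = Qcoef Q f j * Q ^+ j
      & forall j, (j < k)%N -> le (emb h) (emb (Qcoef Q f j * Q ^+ j))].
  elim: k => [|k IHk]; first by left.
  have gE : g k.+1 = g k + Qcoef Q f k * Q ^+ k by rewrite /g big_ord_recr.
  have [c0|c0] := eqVneq (Qcoef Q f k) 0.
    case: IHk => [z|[h [m [n [dom ltn hm [j ltj hj] hmin]]]]].
      by left=> j; rewrite ltnS leq_eqVlt => /predU1P[->|/z].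
    right; exists h, m, n; split=> //.
    - by rewrite gE c0 mul0r addr0.
    - by rewrite mulSn ltn_addl.
    - by exists j => //; apply: ltnW.
    - move=> l; rewrite ltnS leq_eqVlt => /predU1P[->|/hmin //].
      by rewrite c0 mul0r emb0 vle0.
  have [m' [dom' le1 le2]] := termP k c0; right.
  case: IHk => [z|[h [m [n [dom ltn [hm1 hm2] [j ltj hj] hmin]]]]].
    exists (Qcoef Q f k * Q ^+ k), m', (k * N Q)%N; split=> //.
    - rewrite gE /g big1 ?add0r // => j _; rewrite z ?mul0r //; exact: ltn_ord.
    - by rewrite ltn_mul2r NQ /=.
    - by exists k.
    - move=> l; rewrite ltnS leq_eqVlt => /predU1P[->|/z ->];
      first exact: vle_refl.
      by rewrite mul0r emb0 vle0.
  have := dominant_add vo dom dom' ltn; rewrite -SD -gE /vmin.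
  case: ifPn => mm dom''.
    exists (Qcoef Q f k * Q ^+ k), m', (k * N Q)%N; split=> //.
    - by rewrite ltn_mul2r NQ /=.
    - by exists k.
    - move=> l; rewrite ltnS leq_eqVlt => /predU1P[->|/hmin h1];
      first exact: vle_refl.
      by apply: (vle_trans vo le2); apply: (vle_trans vo mm);
        apply: (vle_trans vo hm1).
  exists h, m, n; split=> //.
  - by rewrite mulSn ltn_addl.
  - by exists j => //; apply: ltnW.
  - move=> l; rewrite ltnS leq_eqVlt => /predU1P[->|/hmin //].
    by apply: (vle_trans vo hm2); apply: (vle_trans vo (vltW vo mm)).
case: (partial (size f)) => [z|[h [m [n [dom _ [hm1 hm2] [j ltj hj] hmin]]]]].
  exfalso; move/eqP: f0; apply; rewrite fE big1 // => j _.
  by rewrite z ?mul0r.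
have -> : truncation w Q f = w h%:F.
  apply/le_anti/andP; split; first by rewrite hj;
    apply: (bigmin_le _ (Ordinal ltj)).
  apply: le_bigmin => [|l _]; first by case: (w h%:F).
  by rewrite -le_w; apply: hmin.
rewrite ltNge -le_w -M_lt //; congr negb.
move: dom; rewrite /g -fE => -[m0 mn mle _].
have [M0 MN Mle _] := SMN f0.
have mM : le m (M f) by apply: (vle_trans vo (mle (N f))).
have Mm : le (M f) m by apply: (vle_trans vo (Mle n)).
apply/idP/idP => le_f; apply: (vle_trans vo le_f).
  by apply: (vle_trans vo hm2).
by apply: (vle_trans vo Mm).
Qed.

End Truncation.
End CommonExtension.

(** * Distinguished pairs of key polynomials *)

Section Conjugates.
Variables (K : fieldType) (G : oagType) (v : K -> withtop G).
Hypothesis hens : henselian v.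
Variables (L : closedFieldType) (i : {rmorphism K -> L}).
Hypothesis halg : forall x : L, algebraicOver i x.
Variables (Gb : oagType) (vb : L -> withtop Gb).
Hypotheses (hvb : valuation vb) (hext : extends i v vb).

(** Comparing a power of g(t) with an element of K of the same value upgrades
the comparison of values at conjugate elements to an equality. *)
Lemma conjugate_value_eq (Q g : {poly K}) (t t' : L) :
    irreducible_poly Q -> root (map_poly i Q) t -> root (map_poly i Q) t' ->
  vb (map_poly i g).[t] = vb (map_poly i g).[t'].
Proof.
move=> irrQ Qt Qt'; have vob := valuation_order hvb.
have [gt0|gt0] := eqVneq (map_poly i g).[t] 0.
  have gt0' : root (map_poly i g) t'.
    rewrite (irreducible_dvd _ irrQ Qt') -(irreducible_dvd _ irrQ Qt).
    exact/eqP.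
  by rewrite gt0 (rootP gt0').
have [n [a [n0 a0 h1 h2]]] := algebraic_value vob (halg _) gt0.
have conj := conjugate_value hens halg hvb hext.
have ev s : (map_poly i (g ^+ n)).[s] = (map_poly i g).[s] ^+ n.
  by rewrite rmorphXn horner_exp.
have ec s : (map_poly i a%:P).[s] = i a by rewrite map_polyC hornerC.
have h3 : vb ((map_poly i g).[t'] ^+ n) <= vb (i a).
  by rewrite -ev -(ec t') -(conj Q _ _ t) // ev ec.
have h4 : vb (i a) <= vb ((map_poly i g).[t'] ^+ n).
  by rewrite -ev -(ec t') -(conj Q _ _ t) // ev ec.
apply/le_anti/andP; split.
  by rewrite -(vle_exp2 vob _ _ n0) (le_trans h1).
by rewrite -(vle_exp2 vob _ _ n0) (le_trans h3).
Qed.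

(** By near_root_deriv the existence of a root of f within distance c of t only
depends on the values at t of the derivatives of f. *)
Lemma near_root_conjugate (Q f : {poly K}) (t t' c b : L) :
    irreducible_poly Q -> root (map_poly i Q) t -> root (map_poly i Q) t' ->
    f != 0 -> c != 0 -> root (map_poly i f) b -> vb c <= vb (t - b) ->
  exists2 b', root (map_poly i f) b' & vb c <= vb (t' - b').
Proof.
move=> irrQ Qt Qt' f0 c0 fb cb; have vob := valuation_order hvb.
have [s fE] := closed_field_poly_normal (map_poly i f).
set k := lead_coef _ in fE.
have k0 : k != 0 by rewrite lead_coef_eq0 map_poly_eq0.
have inS x : (x \in s) = root (map_poly i f) x.
  by rewrite fE rootZ // root_prod_XsubC.
have newt z := near_root_deriv vob z k0 c0 fE.
have /newt [n n0 hn] : has (fun a => vb c <= vb (t - a)) s.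
  by apply/hasP; exists b; rewrite ?inS.
have /newt /hasP [b' b's hb'] : exists2 n, (0 < n)%N &
    vb ((map_poly i f)^`N(n).[t'] * c ^+ n) <= vb (map_poly i f).[t'].
  exists n => //; have [_ vbM _] := hvb; move: hn; rewrite !vbM !nderivn_map.
  by rewrite !(conjugate_value_eq _ irrQ Qt Qt').
by exists b'; rewrite -?inS.
Qed.

Lemma degree_root_le (f : {poly K}) b :
  f != 0 -> root (map_poly i f) b -> (degree i b <= pdeg f)%N.
Proof.
move=> f0 fb; have [g [irrg gb]] := ex_irreducible_root (halg b).
rewrite (degree_irreducible irrg gb) /pdeg -!subn1 leq_sub2r // dvdp_leq //.
by rewrite -(irreducible_dvd _ irrg gb).
Qed.

Variables (E : fieldType) (kappa : {rmorphism L -> E}) (X : E).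
Hypothesis X_transc : forall b, X != kappa b.
Variable le : rel E.
Hypothesis vo : value_order le.
Hypothesis le_vb : forall x y, le (kappa x) (kappa y) = (vb x <= vb y).
Variables (H : oagType) (w : {fraction {poly K}} -> withtop H).
Hypothesis hw : valuation w.
Hypothesis le_w : forall f g,
  le (emb i kappa X f) (emb i kappa X g) = (w f%:F <= w g%:F).

Let kappa_sub t b : kappa (t - b) = (X - kappa b) - (X - kappa t).
Proof. by rewrite rmorphB; ring. Qed.

(** Here t - b = (X - b) - (X - t), whose second term has the larger value. *)
Lemma kappa_sub_far t b : ~~ le (X - kappa t) (X - kappa b) ->
  le (kappa (t - b)) (X - kappa b) /\ le (X - kappa b) (kappa (t - b)).
Proof. by rewrite kappa_sub => /(vlt_subl vo). Qed.

Lemma truncation_ltP Q a f : abkp w Q -> nearest_root i kappa X le Q a ->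
  f != 0 ->
  (truncation w Q f < w f%:F) <->
  exists2 b, root (map_poly i f) b & ~~ le (X - kappa b) (X - kappa a).
Proof.
move=> hQ ra f0; rewrite (truncation_lt X_transc vo hw le_w hQ ra f0).
split=> [/hasP [b br h]|[b br h]]; last apply/hasP; exists b => //.
  by rewrite -mem_roots_of.
by rewrite mem_roots_of.
Qed.

Lemma alpha_eqP Q n : (Fin n = alpha w Q) <->
  is_min [set pdeg f | f in [set f | truncation w Q f < w f%:F]]%classic n.
Proof.
rewrite /alpha; split=> [|nmin].
  by case: xgetP => // _ _ [m -> mmin] [->].
apply/esym/xget_unique; first by exists n.
move=> _ [m -> [mS mmin]]; congr Fin; apply/le_anti/andP; split.
  by apply: mmin; case: nmin.
by case: nmin => _; apply.
Qed.

(** Let a and t be the nearest roots of Q and Q'. As Q' is in psi(Q), t is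
nearer to X than a, whereas no element c of degree less than deg Q' is, because
its minimal polynomial f would satisfy w_Q f < w f with a smaller degree. So w
(t - c) = w (X - c) is at most w (X - a) = w (t - a). *)
Lemma psi_distinguished Q Q' : abkp w Q -> abkp w Q' ->
  (pdeg Q < pdeg Q')%N -> psi w Q Q' -> distinguished_pair i vb Q' Q.
Proof.
move=> hQ hQ' lt_deg [_ ltQ' /alpha_eqP [_ minQ']].
have irrQ := abkp_irreducible X_transc vo hw le_w hQ.
have irrQ' := abkp_irreducible X_transc vo hw le_w hQ'.
have [[_ dQ _] [_ dQ' _]] := (hQ, hQ').
have [a ra] := ex_nearest_root i kappa X vo dQ.
have [t rt] := ex_nearest_root i kappa X vo dQ'.
have [[Qa _] [Q't tmax]] := (ra, rt).
have Q'0 := pdeg_gt0_neq0 dQ'.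
have [b Q'b hb] := (truncation_ltP hQ ra Q'0).1 ltQ'.
have at_ : ~~ le (X - kappa t) (X - kappa a) := vlt_le_trans vo hb (tmax b Q'b).
have [at1 at2] := kappa_sub_far at_.
have dega := degree_irreducible irrQ Qa.
have degt := degree_irreducible irrQ' Q't.
split=> //; exists t, a; split=> //; split; first by rewrite dega degt.
- split; first by exists a => //=; rewrite dega degt.
  move=> _ [c /= degc <-]; rewrite -le_vb.
  have [f [irrf fc]] := ex_irreducible_root (halg c).
  have f0 := irredp_neq0 irrf.
  have hc : le (X - kappa c) (X - kappa a).
    apply: contraT => h; exfalso; move: degc;
      rewrite degt (degree_irreducible irrf fc).
    rewrite ltnNge => /negP[]; apply: (minQ'); exists f => //=.
    by apply/(truncation_ltP hQ ra f0); exists c.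
  have ct : ~~ le (X - kappa t) (X - kappa c) by apply: vle_lt_trans hc _.
  have [h1 h2] := kappa_sub_far ct.
  by apply: (vle_trans vo h1); apply: (vle_trans vo hc).
- move=> c; rewrite dega => degc; rewrite ltNge -le_vb.
  have [f [irrf fc]] := ex_irreducible_root (halg c).
  have f0 := irredp_neq0 irrf.
  rewrite (degree_irreducible irrf fc) in degc.
  have ca := abkp_far_roots X_transc vo hw le_w hQ ra f0 degc fc.
  have ct : ~~ le (X - kappa t) (X - kappa c) :=
    vle_lt_trans vo (vltW vo ca) at_.
  have [h1 h2] := kappa_sub_far ct.
  apply: contra ca => h; apply: (vle_trans vo at2); exact: (vle_trans vo h).
Qed.

(** The pair (t, a) is first moved to the nearest root s of Q': some root a' of
Q has w (s - a') >= w (t - a), and w (s - y) <= w (t - a) for every element y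
of degree less than deg Q'. As s is nearer to X than y, w (X - y) = w (s - y)
is at most w (t - a), with equality for the nearest root d of Q; so no
polynomial of degree less than deg Q' has a root nearer than d, whereas Q' has
the root s. *)
Lemma distinguished_psi Q Q' : abkp w Q -> abkp w Q' ->
  distinguished_pair i vb Q' Q -> (pdeg Q < pdeg Q')%N /\ psi w Q Q'.
Proof.
move=> hQ hQ' [irrQ' irrQ [t [a [Q't Qa [lt_deg [_ tmax] _]]]]].
have degt := degree_irreducible irrQ' Q't.
rewrite degt (degree_irreducible irrQ Qa) in lt_deg; split=> //.
have [[_ dQ _] [Q'mon dQ' _]] := (hQ, hQ').
have [Q0 Q'0] := (pdeg_gt0_neq0 dQ, pdeg_gt0_neq0 dQ').
have [d rd] := ex_nearest_root i kappa X vo dQ.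
have [s rs] := ex_nearest_root i kappa X vo dQ'.
have [[Qd dmax] [Q's smax]] := (rd, rs).
have neq_small x y : root (map_poly i Q') x -> (degree i y < pdeg Q')%N ->
  x - y != 0.
  move=> Q'x; apply: contraTneq => /eqP; rewrite subr_eq0 => /eqP <-.
  by rewrite (degree_irreducible irrQ' Q'x) ltnn.
have c0 : t - a != 0 by apply: neq_small => //;
  rewrite (degree_irreducible irrQ Qa).
have [a' Qa' ha'] := near_root_conjugate irrQ' Q't Q's Q0 c0 Qa (lexx _).
have small y : (degree i y < pdeg Q')%N ->
    ~~ le (X - kappa s) (X - kappa y) /\ le (X - kappa y) (kappa (t - a)).
  move=> ylt; have [f [irrf fy]] := ex_irreducible_root (halg y).
  have f0 := irredp_neq0 irrf; have degy := degree_irreducible irrf fy.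
  have far : ~~ le (X - kappa s) (X - kappa y).
    by apply: (abkp_far_roots X_transc vo hw le_w hQ' rs f0) fy; rewrite -degy.
  split=> //; have [_ h2] := kappa_sub_far far; apply: (vle_trans vo h2).
  have [y' fy' hy'] :=
    near_root_conjugate irrQ' Q's Q't f0 (neq_small _ _ Q's ylt) fy (lexx _).
  rewrite le_vb; apply: (le_trans hy'); apply: tmax; exists y' => //=.
  by rewrite degt (degree_irreducible irrf fy') -degy.
have degd : (degree i d < pdeg Q')%N by rewrite (degree_irreducible irrQ Qd).
have dega' : (degree i a' < pdeg Q')%N by rewrite (degree_irreducible irrQ Qa').
have [far_a' _] := small a' dega'; have [h1 _] := kappa_sub_far far_a'.
have le_d : le (kappa (t - a)) (X - kappa d).
  apply: (vle_trans vo (y := kappa (s - a'))); first by rewrite le_vb.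
  by apply: (vle_trans vo h1); apply: dmax.
have ltQ' : truncation w Q Q' < w Q'%:F.
  by apply/(truncation_ltP hQ rd Q'0); exists s => //; have [] := small d degd.
split=> //; apply/alpha_eqP; split; first by exists Q'.
move=> _ [f /= ltf <-]; change (pdeg Q' <= pdeg f)%N; rewrite leqNgt;
  apply/negP => deg_f.
have [f0|f0] := eqVneq f 0.
  by move: ltf;
    rewrite f0 /truncation size_poly0 big_ord0 rmorph0 valuation0 // ltxx.
have [y fy hy] := (truncation_ltP hQ rd f0).1 ltf.
have [_ h2] := small y (leq_ltn_trans (degree_root_le f0 fy) deg_f).
by move/negP: hy; apply; apply: (vle_trans vo h2).
Qed.

End Conjugates.

(** * Common extensions of the valuations in Kbar(X) *)

Section Ambient.
Variables (K : fieldType) (L : closedFieldType) (i : {rmorphism K -> L}).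

Definition const_frac : {rmorphism L -> {fraction {poly L}}} :=
  (@FracField.tofrac {poly L} \o polyC).

Lemma emb_frac (f : {poly K}) :
  emb i const_frac ('X%:F) f = (map_poly i f)%:F.
Proof.
rewrite /emb /poly_over; set p := map_poly i f.
transitivity (map_poly (@FracField.tofrac {poly L}) (map_poly polyC p)).['X%:F].
  by congr (_.[_]); rewrite -[RHS]map_poly_comp.
by rewrite horner_map; congr (_ %:F); rewrite -[RHS]comp_polyXr.
Qed.

End Ambient.

Theorem corollary1p18
  (K : fieldType) (G : oagType) (v : K -> withtop G)
  (hv : valuation v) (hens : henselian v)
  (Kbar : closedFieldType) (i : {rmorphism K -> Kbar})
  (halg : forall x : Kbar, algebraicOver i x)
  (Gbar : oagType) (vbar : Kbar -> withtop Gbar)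
  (hvbar : valuation vbar) (hext : extends i v vbar)
  (H : oagType) (w : {fraction {poly K}} -> withtop H)
  (hw : valuation w) (hwext : extends (fun c : K => (c%:P)%:F) v w)
  (Q : {poly K}) (hQ : abkp w Q) :
  (exists (r : nat) (s : nat -> {poly K}),
     saturated_distinguished_chain i vbar w Q r s)
  <->
  (exists (r : nat) (s : nat -> {poly K}),
     [/\ s r = Q,
         forall k : nat, (k <= r)%N -> abkp w (s k),
         pdeg (s 0%N) = 1%N
       & forall k : nat, (1 <= k <= r)%N ->
           (pdeg (s k.-1) < pdeg (s k))%N /\ psi w (s k.-1) (s k)]).
Proof.
pose E := {fraction {poly Kbar}}; pose kappa := const_frac Kbar.
pose X : E := 'X%:F.
pose iota : {rmorphism {poly K} -> E} :=
  @FracField.tofrac {poly Kbar} \o map_poly i.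
have tofrac_inj (R : idomainType) : injective (@FracField.tofrac R).
  by move=> x y /eqP; rewrite tofrac_eq => /eqP.
have iota_inj : injective iota by move=> f g /tofrac_inj/map_poly_inj.
have vow := value_order_comp (@tofrac_inj _) (valuation_order hw).
have [le vo le_iota] := extend_value_order iota_inj vow.
have le_w f g : le (emb i kappa X f) (emb i kappa X g) = (w f%:F <= w g%:F).
  by rewrite !emb_frac -le_iota.
have X_transc b : X != kappa b.
  rewrite tofrac_eq; apply/eqP => /(congr1 (fun p : {poly Kbar} => size p)).
  by rewrite size_polyX size_polyC; case: (b != 0).
have kappa_inj : injective kappa := fmorph_inj kappa.
have voL := value_order_comp kappa_inj vo.
have le_v a b : le (kappa (i a)) (kappa (i b)) = (v a <= v b).
  have e c : kappa (i c) = iota c%:P by rewrite /iota /= map_polyC.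
  rewrite !e le_iota; have [j [jmono jv]] := hwext; rewrite !jv.
  by case: (v a) (v b) => [g|] [g'|] //=; apply: jmono.
have le_vb := henselian_order hens halg hvbar hext voL le_v.
have psi_dist := psi_distinguished halg X_transc vo le_vb hw le_w.
have dist_psi :=
  distinguished_psi hens halg hvbar hext X_transc vo le_vb hw le_w.
split=> -[r [s]].
  move=> [sr abk dist deg0]; exists r, s; split=> // k /andP[k0 kr].
  have k'r : (k.-1 <= r)%N := leq_trans (leq_pred k) kr.
  by apply: dist_psi; [apply: abk|apply: abk|apply: dist; rewrite k0].
move=> [sr abk deg0 chain]; exists r, s; split=> // k /andP[k0 kr].
have k'r : (k.-1 <= r)%N := leq_trans (leq_pred k) kr.
have [|lt_deg psik] := chain k; first by rewrite k0.
by apply: psi_dist => //; apply: abk.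
Qed.
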